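(* Let $A\in\mathcal V$, $\gamma>0$ and $\mathcal A\subseteq\mathcal V$ with $\sqrt\gamma A\in\overline{\mathcal A}$ (closure in $\mathcal V$). Let $\mathcal K,\psi_l,\eta_l,\phi_k,W$ and the scores $\chi_l^A,\chi_l^O,\zeta_k^A,\zeta_k^O$ be as defined in the context. Consider the condition $$(\ast)\qquad\sum_{k=1}^\infty\sum_{l=1}^\infty\frac{\left(\gamma\mathbb E[\zeta_k^A\chi_l^A]+(1-\gamma)\mathbb E[\zeta_k^O\chi_l^O]\right)^2}{\left(\gamma\mathbb E[(\chi_l^A)^2]+(1-\gamma)\mathbb E[(\chi_l^O)^2]\right)^2}<\infty .$$ Then there is a unique solution $$\arg\min_{\beta\in L^2([T_1,T_2]^2)^p}\ \sup_{A'\in C^\gamma_{\mathcal A}(A)}R_{A'}(\beta)=\sum_{k=1}^\infty\sum_{l=1}^\infty\frac{\gamma\mathbb E[\zeta_k^A\chi_l^A]+(1-\gamma)\mathbb E[\zeta_k^O\chi_l^O]}{\gamma\mathbb E[(\chi_l^A)^2]+(1-\gamma)\mathbb E[(\chi_l^O)^2]}\,\phi_k\otimes\psi_l$$ if and only if $(\ast)$ holds and $\mathcal K$ is injective. If $(\ast)$ holds but $\mathcal K$ is not injective, then the set of minimizers is $$\arg\min_{\beta\in L^2([T_1,T_2]^2)^p}\ \sup_{A'\in C^\gamma_{\mathcal A}(A)}R_{A'}(\beta)=\left\{\sum_{k=1}^\infty\sum_{l=1}^\infty\frac{\gamma\mathbb E[\zeta_k^A\chi_l^A]+(1-\gamma)\mathbb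 E[\zeta_k^O\chi_l^O]}{\gamma\mathbb E[(\chi_l^A)^2]+(1-\gamma)\mathbb E[(\chi_l^O)^2]}\,\phi_k\otimes\psi_l\right\}+W .$$
   Context: Let $T_1<T_2$, $p\ge1$, and $H=L^2([T_1,T_2])$ (real, Lebesgue measure). Product spaces $H^k$ carry the sum inner product; elements are written as row vectors. Fix a probability space $(\Omega,\mathcal F,\mathbb P)$. $\mathcal V$ is the Hilbert space of $\mathcal F$-Borel measurable random elements $U=(U(1),\dots,U(p+1))$ of $H^{p+1}$ with $\|U\|_{\mathcal V}^2=\sum_{i=1}^{p+1}\int_{[T_1,T_2]}\mathbb E[U_t(i)^2]dt<\infty$. Structural operator: $\mathcal T:D(\mathcal T)\to H^{p+1}$, $D(\mathcal T)\subseteq H^{p+1}$, is an operator such that $\mathrm{Range}(I-\mathcal T)$ is dense in $H^{p+1}$ and is a Lusin space, and $\mathcal S=(I-\mathcal T)^{-1}$ exists and is bounded and linear on $\mathrm{Range}(I-\mathcal T)$; $\mathcal S$ also denotes its bounded linear extension to all of $H^{p+1}$. Environments: fix noise $\epsilon\in\mathcal V$ with $\mathbb E[\epsilon]=0$ (Bochner). For $A\in\mathcal V$, extend the probability space to $(\Omega_A,\mathcal F_A,\mathbb P_A)$ (expectation $\mathbb E_A$) carrying a copy $\epsilon_A$ of $\epsilon$ (same law) independent of $A$, and set $(Y^A,X^A)=\mathcal S(A+\epsilon_A)$, with $Y^A$ the first coordinate ($H$-valued) and $X^A=(X^A(1),\dots,X^A(p))$ the remaining $p$ coordinates. The observational environment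 $O$ is the case $A=0$: $(Y^O,X^O)=\mathcal S\epsilon_O$. Risk: for $\beta=(\beta(1),\dots,\beta(p))\in L^2([T_1,T_2]^2)^p$, $$R_A(\beta)=\mathbb E_A\Big[\int_{[T_1,T_2]}\Big(Y^A_t-\int_{[T_1,T_2]}\sum_{i=1}^p(\beta(i))(t,\tau)X^A_\tau(i)\,d\tau\Big)^2dt\Big].$$ Shift sets: for $A\in\mathcal V$ let $K_A(s,t)$ be the $(p+1)\times(p+1)$ matrix with entries $\mathbb E[A_s(i)A_t(j)]$. For $\mathcal A\subseteq\mathcal V$ and $\gamma>0$, $$C^\gamma_{\mathcal A}(A)=\Big\{A'\in\mathcal A:\int_{[T_1,T_2]^2}g(s)K_{A'}(s,t)g(t)^T\,ds\,dt\le\gamma\int_{[T_1,T_2]^2}g(s)K_A(s,t)g(t)^T\,ds\,dt\ \ \forall g\in H^{p+1}\Big\}.$$ Eigenbasis: with $K_{X^A}(s,t)$, $K_{X^O}(s,t)$ the $p\times p$ matrices with entries $\mathbb E[X^A_s(i)X^A_t(j)]$, $\mathbb E[X^O_s(i)X^O_t(j)]$, let $\mathcal K:H^p\to H^p$ be the compact self-adjoint operator $$(\mathcal Kf)(t)=\gamma\int_{[T_1,T_2]}f(s)K_{X^A}(s,t)\,ds+(1-\gamma)\int_{[T_1,T_2]}f(s)K_{X^O}(s,t)\,ds$$ ($f$ a row vector). Let $\{\psi_l\}$ be an orthonormal system in $H^p$ of eigenfunctions of $\mathcal K$ for its nonzero eigenvalues (complete in $\mathrm{Ker}(\mathcal K)^\perp$),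 and $\{\eta_l\}$ an orthonormal basis of $\mathrm{Ker}(\mathcal K)$; if one of these systems is finite, sums over its index run over the available indices. Let $\{\phi_k\}_{k\in\mathbb N}$ be an arbitrary orthonormal basis of $H$. For $\phi\in H$, $\psi\in H^p$, $(\phi\otimes\psi)(t,\tau)=\phi(t)\psi(\tau)$, an element of $L^2([T_1,T_2]^2)^p$. Put $$W=\Big\{\sum_{k}\sum_{l}\alpha_{k,l}\,\phi_k\otimes\eta_l:\ \sum_{k}\sum_l\alpha_{k,l}^2<\infty\Big\}.$$ Scores: $\chi_l^A=\langle X^A,\psi_l\rangle_{H^p}$, $\chi_l^O=\langle X^O,\psi_l\rangle_{H^p}$, $\zeta_k^A=\langle Y^A,\phi_k\rangle_H$, $\zeta_k^O=\langle Y^O,\phi_k\rangle_H$. Expectations of quantities of environment $A$ (resp. $O$) are taken under $\mathbb P_A$ (resp. $\mathbb P_O$).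
   Formalization: The assumption that √γA lies in the closure of 𝒜 is strengthened to √γA lying in the closure of C^γ_𝒜(A); without it the claim fails, e.g. for 𝒜={(1+1/n)√γA : n≥1} with A≠0, where the shift set is empty and every β minimizes. *)

(* Defs.v *)
From HB Require Import structures.
From mathcomp Require Import all_boot all_order all_algebra.
From mathcomp Require Import all_classical all_reals all_analysis.
From mathcomp Require Import measurable_realfun.
From mathcomp Require Import ring lra.

Set Implicit Arguments.
Unset Strict Implicit.
Unset Printing Implicit Defensive.
Import Order.TTheory GRing.Theory Num.Theory.
Import numFieldNormedType.Exports.

Local Open Scope classical_set_scope.
Local Open Scope ring_scope.

(* L^2(mu)^k, represented by k-tuples of square-integrable functions. Two
   representatives denote the same element when they are equal mu-almost
   everywhere, which is the relation eqL2; the norm below is a seminorm on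
   representatives, and the Hilbert space is the quotient by eqL2. *)
Section L2space.
Context (R : realType) (d : measure_display) (T : measurableType d).
Variables (mu : {measure set T -> \bar R}) (k : nat).

Definition L2 := {ffun 'I_k -> LfunType mu (lee1n 2)}.

HB.instance Definition _ := GRing.Lmodule.on L2.

Implicit Types f g h : L2.

Definition eqL2 f g : Prop := forall i, {ae mu, forall t, f i t = g i t}.

Definition dotL2 f g : R := \sum_(i < k) \int[mu]_t (f i t * g i t).

Definition normL2 f : R := Num.sqrt (dotL2 f f).

Lemma L2D f g i t : (f + g) i t = f i t + g i t.
Proof. by rewrite ffunE. Qed.

Lemma L2N f i t : (- f) i t = - f i t.
Proof. by rewrite ffunE. Qed.

Lemma L2Z (a : R) f i t : (a *: f) i t = a * f i t.
Proof. by rewrite ffunE. Qed.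

Lemma L2_integrableM f g i :
  mu.-integrable setT (EFin \o (fun t => f i t * g i t)).
Proof. by apply/Lfun1_integrable/Lfun2_mul_Lfun1; exact: LfunP. Qed.

Lemma dotL2C f g : dotL2 f g = dotL2 g f.
Proof.
apply: eq_bigr => i _; apply: eq_Rintegral => t _; exact: mulrC.
Qed.

Lemma dotL2Dl f g h : dotL2 (f + g) h = dotL2 f h + dotL2 g h.
Proof.
rewrite /dotL2 -big_split/=; apply: eq_bigr => i _.
rewrite -RintegralD//; [|exact: L2_integrableM..].
by apply: eq_Rintegral => t _; rewrite L2D mulrDl.
Qed.

Lemma dotL2Zl a f g : dotL2 (a *: f) g = a * dotL2 f g.
Proof.
rewrite /dotL2 mulr_sumr; apply: eq_bigr => i _.
rewrite -RintegralZl//; last exact: L2_integrableM.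
by apply: eq_Rintegral => t _; rewrite L2Z mulrA.
Qed.

Lemma dotL2Dr f g h : dotL2 f (g + h) = dotL2 f g + dotL2 f h.
Proof. by rewrite dotL2C dotL2Dl !(dotL2C f). Qed.

Lemma dotL2Zr a f g : dotL2 f (a *: g) = a * dotL2 f g.
Proof. by rewrite dotL2C dotL2Zl (dotL2C f). Qed.

Lemma dotL2_ge0 f : 0 <= dotL2 f f.
Proof.
by apply: sumr_ge0 => i _; apply: Rintegral_ge0 => t _; rewrite -expr2 sqr_ge0.
Qed.

Lemma dotL2_le_norm f g : dotL2 f g <= normL2 f * normL2 g.
Proof.
have [fg0|fg0] := leP (dotL2 f g) 0.
  by rewrite (le_trans fg0)// mulr_ge0// sqrtr_ge0.
have key x : 0 <= dotL2 f f + x * (2 * dotL2 f g) + x ^+ 2 * dotL2 g g.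
  have := dotL2_ge0 (f + x *: g).
  rewrite dotL2Dl !dotL2Dr !dotL2Zl !dotL2Zr (dotL2C g f); lra.
have gg : 0 < dotL2 g g.
  rewrite lt_neqAle dotL2_ge0 andbT; apply/negP => /eqP gg0.
  have := key (- (dotL2 f f + 1) / (2 * dotL2 f g)).
  by rewrite -gg0 divfK ?mulr0//; [lra|lra].
rewrite -[dotL2 f g]ger0_norm ?(ltW fg0)// -sqrtr_sqr /normL2.
rewrite -sqrtrM ?dotL2_ge0// ler_sqrt ?mulr_ge0 ?dotL2_ge0//.
have := key (- dotL2 f g / dotL2 g g).
set a := dotL2 f f; set b := dotL2 f g; set c := dotL2 g g in gg *.
have -> : a + - b / c * (2 * b) + (- b / c) ^+ 2 * c = (a * c - b ^+ 2) / c.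
  by field; rewrite gt_eqF.
by rewrite pmulr_lge0 ?invr_gt0// subr_ge0.
Qed.

Lemma normL2D f g : normL2 (f + g) <= normL2 f + normL2 g.
Proof.
rewrite -[leRHS]ger0_norm ?addr_ge0 ?sqrtr_ge0// -sqrtr_sqr [leLHS]/normL2.
rewrite ler_sqrt ?sqr_ge0// dotL2Dl !dotL2Dr (dotL2C g f).
rewrite sqrrD !sqr_sqrtr ?dotL2_ge0//.
by have := dotL2_le_norm f g; lra.
Qed.

Lemma normL2N f : normL2 (- f) = normL2 f.
Proof. by rewrite /normL2 -scaleN1r dotL2Zl dotL2Zr mulrA mulrNN !mul1r. Qed.

Lemma normL2_0 : normL2 0 = 0.
Proof. by rewrite /normL2 -(scale0r 0) dotL2Zl mul0r sqrtr0. Qed.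

Definition ballL2 := ball_ normL2.

Definition entL2 : set_system (L2 * L2) := entourage_ ballL2.

Definition nbhsL2 (f : L2) : set_system L2 := nbhs_ entL2 f.

Lemma nbhsL2E : nbhsL2 = nbhs_ entL2. Proof. by []. Qed.

HB.instance Definition _ := hasNbhs.Build L2 nbhsL2.

Lemma ballL2_center f (e : R) : 0 < e -> ballL2 f e f.
Proof. by rewrite /ballL2/= subrr normL2_0. Qed.

Lemma ballL2_sym f g (e : R) : ballL2 f e g -> ballL2 g e f.
Proof. by rewrite /ballL2/= -normL2N opprB. Qed.

Lemma ballL2_triangle f g h (e1 e2 : R) :
  ballL2 f e1 g -> ballL2 g e2 h -> ballL2 f (e1 + e2) h.
Proof.
rewrite /ballL2/= => fg gh; rewrite -[f](subrK g) -addrA.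
by rewrite (le_lt_trans (normL2D _ _))// ltrD.
Qed.

Lemma entL2E : entL2 = entourage_ ballL2. Proof. by []. Qed.

HB.instance Definition _ := @Nbhs_isPseudoMetric.Build R L2
  entL2 nbhsL2E ballL2 ballL2_center ballL2_sym ballL2_triangle entL2E.

Definition borelL2 : set (set L2) := <<s [set B | open B] >>.

(* A subset is Lusin when it is the image of a Polish space by a continuous
   injection; injectivity and image are meant up to eqL2. *)
Definition lusinL2 (M : set L2) : Prop :=
  exists Z : completePseudoMetricType R,
    [/\ hausdorff_space Z, @second_countable Z &
      exists u : Z -> L2,
        [/\ continuous u, forall z z', eqL2 (u z) (u z') -> z = z',
            forall z, M (u z) & forall f, M f -> exists z, eqL2 (u z) f]].

(* Index sets of finite or infinite sequences. *)
Definition initial_segment (J : set nat) : Prop :=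
  J = setT \/ exists n, J = `I_n.

(* (e_l)_{l in J} is an orthonormal basis of the closed subspace M. *)
Definition orthonormal_basis (M : set L2) (J : set nat) (e : nat -> L2) : Prop :=
  [/\ initial_segment J,
      forall l m, J l -> J m -> dotL2 (e l) (e m) = (l == m)%:R,
      forall l, J l -> M (e l) &
      forall f, M f ->
        (\sum_(l < n | (l : nat) \in J) dotL2 f (e l) *: e l) @[n --> \oo] --> f].

End L2space.

Section tensor.
Context (R : realType) (d : measure_display) (T : measurableType d).
Variable mu : {sigma_finite_measure set T -> \bar R}.
Local Notation mu2 := (mu \x mu)%E.

Section tensor_fun.
Variables f g : LfunType mu (@lee1n R 2).

Definition tensor_fun (z : T * T) : R := f z.1 * g z.2.

Lemma measurable_tensor_fun : measurable_fun setT tensor_fun.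
Proof. by apply: measurable_funM; exact: measurableT_comp. Qed.

Lemma finite_norm_tensor_fun : finite_norm mu2 2%:E tensor_fun.
Proof.
have sqI (h : LfunType mu (@lee1n R 2)) :
    mu.-integrable setT (EFin \o (fun t => h t ^+ 2)).
  by apply: Lfun2_integrable_sqr; exact: LfunP.
have sqlty (h : LfunType mu (@lee1n R 2)) : (\int[mu]_t (h t ^+ 2)%:E < +oo)%E.
  exact: integrable_lty (sqI h).
rewrite /finite_norm unlock /Lnorm; apply: poweR_lty.
rewrite (eq_integral (fun z => (f z.1 ^+ 2 * g z.2 ^+ 2)%:E)); last first.
  by move=> z _; rewrite /= powR_mulrn// real_normK ?num_real// exprMn.
rewrite fubini_tonelli1/=; last 2 first.
- apply/measurable_EFinP; apply: measurable_funM; apply: measurable_funX;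
    exact: measurableT_comp.
- by move=> z; rewrite lee_fin mulr_ge0// sqr_ge0.
rewrite (eq_integral (fun x => (f x ^+ 2)%:E * \int[mu]_y (g y ^+ 2)%:E)%E); last first.
  move=> x _; rewrite -ge0_integralZl//.
  - by apply/measurable_EFinP; exact: measurable_funX.
  - by move=> y _; rewrite lee_fin sqr_ge0.
  - by rewrite lee_fin sqr_ge0.
rewrite ge0_integralZr//=; last 3 first.
- by apply/measurable_EFinP; exact: measurable_funX.
- by move=> y _; rewrite lee_fin sqr_ge0.
- by apply: integral_ge0 => y _; rewrite lee_fin sqr_ge0.
by rewrite lte_mul_pinfty ?ge0_fin_numE ?integral_ge0// => y _; rewrite lee_fin sqr_ge0.
Qed.

HB.instance Definition _ :=
  isMeasurableFun.Build _ _ _ _ tensor_fun measurable_tensor_fun.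
HB.instance Definition _ :=
  isLfunction.Build _ _ R mu2 2%:E (@lee1n R 2) tensor_fun finite_norm_tensor_fun.

Definition tensor_Lfun : LfunType mu2 (@lee1n R 2) := tensor_fun.

End tensor_fun.

Variable k : nat.
Implicit Types (e : nat -> L2 mu k) (J : set nat).

Definition tensorL2 (phi : L2 mu 1) (psi : L2 mu k) : L2 mu2 k :=
  [ffun i => tensor_Lfun (phi ord0) (psi i)].

(* The iterated series sum_i (sum_{l in J} c_{i,l} phi_i (x) e_l) converges
   in L^2(mu \x mu)^k and its sum is b. *)
Definition tensor_series (c : nat -> nat -> R) (phi : nat -> L2 mu 1) J e
    (b : L2 mu2 k) : Prop :=
  exists s : nat -> L2 mu2 k,
    (forall i, (\sum_(l < n | (l : nat) \in J) c i l *: tensorL2 (phi i) (e l))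
       @[n --> \oo] --> s i) /\
    (\sum_(i < n) s i) @[n --> \oo] --> b.

Definition summable2 (c : nat -> nat -> R) J : Prop :=
  (\sum_(0 <= i <oo) \sum_(0 <= l <oo | l \in J) (c i l ^+ 2)%:E < +oo)%E.

Definition tensor_span (phi : nat -> L2 mu 1) J e : set (L2 mu2 k) :=
  [set w | exists alpha, summable2 alpha J /\ tensor_series alpha phi J e w].

End tensor.

Section random_elements.
Context (R : realType) (dO : measure_display) (Omega : measurableType dO).
Variable P : probability Omega R.
Context (d : measure_display) (T : measurableType d).
Variables (mu : {sigma_finite_measure set T -> \bar R}) (k : nat).
Implicit Types U : Omega -> L2 mu k.

Definition sqnormV U : \bar R :=
  (\sum_(i < k) \int[mu]_t 'E_P[fun w => (U w i t ^+ 2)%R])%E.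

(* A random element is a Borel map into L^2(mu)^k. Writing U_t(i) requires a
   jointly measurable version (which every Borel random element of this
   separable space has), hence the field Vspace_joint. *)
Record Vspace := MkVspace {
  Vspace_fun :> Omega -> L2 mu k;
  Vspace_borel : forall B, borelL2 B -> measurable (Vspace_fun @^-1` B);
  Vspace_joint : forall i,
    measurable_fun setT (fun z : Omega * T => Vspace_fun z.1 i z.2);
  Vspace_fin : (sqnormV Vspace_fun < +oo)%E }.

Definition closureV (calA : set Vspace) U : Prop :=
  forall e : R, 0 < e ->
    exists2 A' : Vspace, calA A' &
      (sqnormV (fun w => A' w - U w)%R `^ 2^-1 < e%:E)%E.

Definition Vspace_zero : Vspace.
Proof.
exists (fun=> 0).
- by move=> B _; rewrite preimage_cst; case: ifP.
- move=> i; rewrite (_ : (fun _ => _) = cst 0); first exact: measurable_cst.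
  by apply/funext => z /=; rewrite ffunE.
- rewrite /sqnormV big1 ?ltry// => i _; apply: integral0_eq => t _.
  rewrite (_ : (fun _ => _) = cst 0) ?expectation_cst//.
  by apply/funext => w /=; rewrite ffunE expr0n.
Defined.

(* m is the Bochner integral of U: a list of pairs (B_j, x_j) stands for the
   simple function sum_j 1_{B_j} x_j. *)
Definition bochner_expectation U (m : L2 mu k) : Prop :=
  exists s : nat -> seq (set Omega * L2 mu k),
    [/\ forall n x, x \in s n -> measurable x.1,
        (\int[P]_w (normL2 (U w - \sum_(x <- s n) \1_(x.1) w *: x.2))%:E)%E
          @[n --> \oo] --> 0%E &
        (\sum_(x <- s n) fine (P x.1) *: x.2) @[n --> \oo] --> m].

Definition moment_kernel U (s t : T) : 'M[R]_k :=
  \matrix_(i, j) fine 'E_P[fun w => U w i s * U w j t].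

Definition kernel_form U (g : L2 mu k) : R :=
  \int[(mu \x mu)%E]_z
    ((\row_i g i z.1 *m moment_kernel U z.1 z.2 *m (\row_i g i z.2)^T) 0 0).

Definition shift_set (gamma : R) (calA : set Vspace) (A : Vspace)
    : set Vspace :=
  [set A' | calA A' /\
    forall g, kernel_form A' g <= gamma * kernel_form A g].

End random_elements.

Section structural_operator.
Context (R : realType) (d : measure_display) (T : measurableType d).
Variables (mu : {sigma_finite_measure set T -> \bar R}) (k : nat).
Local Notation E := (L2 mu k).

Definition range_id_sub (D : set E) (Top : E -> E) : set E :=
  [set h | exists2 f, D f & eqL2 h (f - Top f)].

(* S is the inverse of I - Top on its range together with its bounded linear
   extension to the whole space; injectivity of I - Top on D follows from
   so_inverse. *)
Record structural_operator (D : set E) (Top S : E -> E) : Prop := {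
  so_dom : forall f g, eqL2 f g -> D f -> D g;
  so_fun : forall f g, eqL2 f g -> D f -> eqL2 (Top f) (Top g);
  so_dense : dense (range_id_sub D Top);
  so_lusin : lusinL2 (range_id_sub D Top);
  so_range : forall (a : R) f g, range_id_sub D Top f -> range_id_sub D Top g ->
    range_id_sub D Top (a *: f + g);
  so_inverse : forall f, D f -> eqL2 (S (f - Top f)) f;
  so_linear : forall (a : R) f g, eqL2 (S (a *: f + g)) (a *: S f + S g);
  so_bounded : exists M : R, forall f, normL2 (S f) <= M * normL2 f }.

End structural_operator.

Section environments.
Context (R : realType) (d : measure_display) (T : measurableType d).
Variables (mu : {sigma_finite_measure set T -> \bar R}) (p : nat).
Context (dO : measure_display) (Omega : measurableType dO).
Variables (P : probability Omega R).
Variables (S : L2 mu p.+1 -> L2 mu p.+1) (eps : Vspace P mu p.+1).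
Local Notation mu2 := (mu \x mu)%E.

(* env_ext is the projection of the extended probability space on the
   original one, along which A is transported; env_YX is a jointly measurable
   version of S(A + eps_A). *)
Record environment (A : Vspace P mu p.+1) := MkEnvironment {
  env_disp : measure_display;
  env_space : measurableType env_disp;
  env_P : probability env_space R;
  env_ext : {mfun env_space >-> Omega};
  env_extE : forall B, measurable B -> env_P (env_ext @^-1` B) = P B;
  env_eps : env_space -> L2 mu p.+1;
  env_eps_borel : forall B, borelL2 B -> measurable (env_eps @^-1` B);
  env_eps_law : forall B, borelL2 B ->
    env_P (env_eps @^-1` B) = P (eps @^-1` B);
  env_indep : forall B C, borelL2 B -> borelL2 C ->
    (env_P ((A \o env_ext) @^-1` B `&` env_eps @^-1` C) =
     env_P ((A \o env_ext) @^-1` B) * env_P (env_eps @^-1` C))%E;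
  env_YX : Vspace env_P mu p.+1;
  env_YXE : {ae env_P,
    forall w, eqL2 (env_YX w) (S (A (env_ext w) + env_eps w))} }.

Section one_environment.
Variables (A : Vspace P mu p.+1) (E : environment A).

Definition env_Y (w : env_space E) : L2 mu 1 := [ffun=> env_YX E w ord0].

Definition env_X (w : env_space E) : L2 mu p :=
  [ffun i => env_YX E w (lift ord0 i)].

Definition risk (beta : L2 mu2 p) : \bar R :=
  (\int[env_P E]_w \int[mu]_t
    ((env_Y w ord0 t -
      \int[mu]_tau (\sum_(i < p) beta i (t, tau) * env_X w i tau)) ^+ 2)%:E)%E.

Definition cross_moment (phi : L2 mu 1) (psi : L2 mu p) : R :=
  fine 'E_(env_P E)[fun w => dotL2 (env_Y w) phi * dotL2 (env_X w) psi].

Definition square_moment (psi : L2 mu p) : R :=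
  fine 'E_(env_P E)[fun w => dotL2 (env_X w) psi ^+ 2].

End one_environment.

Definition worst_risk (env : forall A, environment A)
    (C : set (Vspace P mu p.+1)) (beta : L2 mu2 p) : \bar R :=
  ereal_sup [set risk (env A') beta | A' in C].

Definition worst_risk_argmin (env : forall A, environment A)
    (C : set (Vspace P mu p.+1)) : set (L2 mu2 p) :=
  [set beta | forall beta',
    (worst_risk env C beta <= worst_risk env C beta')%E].

Section two_environments.
Variables (gamma : R) (A O : Vspace P mu p.+1).
Variables (EA : environment A) (EO : environment O).

(* h represents the image of f by the operator calK. *)
Definition calK (f h : L2 mu p) : Prop :=
  forall j, {ae mu, forall t, h j t =
    gamma * \int[mu]_s (\row_i f i s *m
      moment_kernel (env_P EA) (@env_X _ EA) s t) 0 j +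
    (1 - gamma) * \int[mu]_s (\row_i f i s *m
      moment_kernel (env_P EO) (@env_X _ EO) s t) 0 j}.

Definition calK_injective : Prop :=
  forall f g h, calK f h -> calK g h -> eqL2 f g.

Definition kerK : set (L2 mu p) := [set f | calK f 0].

Definition orthoL2 (M : set (L2 mu p)) : set (L2 mu p) :=
  [set f | forall g, M g -> dotL2 f g = 0].

Definition coef (phi : nat -> L2 mu 1) (psi : nat -> L2 mu p) (k l : nat) : R :=
  (gamma * cross_moment EA (phi k) (psi l) +
   (1 - gamma) * cross_moment EO (phi k) (psi l)) /
  (gamma * square_moment EA (psi l) + (1 - gamma) * square_moment EO (psi l)).

End two_environments.
End environments.

Section interval.
Context (R : realType).
Variables T1 T2 : R.
Local Notation lambda :=
  (@lebesgue_measure R : {measure set (measurableTypeR R) -> \bar R}).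

Lemma measurable_T1T2 : @measurable _ (measurableTypeR R) `[T1, T2].
Proof. exact: measurable_itv. Qed.

Lemma lebesgue_T1T2_lty : (lambda `[T1, T2]%classic < +oo)%E.
Proof.
by rewrite /= lebesgue_measure_itv/=; case: ifPn => _; rewrite -?EFinB ltry.
Qed.

(* Lebesgue measure restricted to [T1, T2]. *)
Definition leb : {finite_measure set (measurableTypeR R) -> \bar R} :=
  mfrestr measurable_T1T2 lebesgue_T1T2_lty.

End interval.

(* Main.v *)
Require Import Defs.
From HB Require Import structures.
From mathcomp Require Import all_boot all_order all_algebra.
From mathcomp Require Import all_classical all_reals all_analysis.
From mathcomp Require Import measurable_realfun.
From mathcomp Require Import ring lra.

Set Implicit Arguments.
Unset Strict Implicit.
Unset Printing Implicit Defensive.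
Import Order.TTheory GRing.Theory Num.Theory.
Import numFieldNormedType.Exports.

Local Open Scope classical_set_scope.
Local Open Scope ring_scope.

(* By Riesz, <S f, h> = <f, S* h>. Independence and the centring of the noise
   therefore give
     E_A'[<(Y, X), h>^2] = kernel_form A' (S* h) + kernel_form eps (S* h).
   For the orthonormal basis phi of H, Parseval turns the risk into the sum over
   k of these second moments at the residual directions
   h_k = (phi_k, - int phi_k(t) beta(t, .) dt). On the shift set each kernel form
   is at most gamma times that of A, and hC makes the bound sharp, so that the
   worst risk is sum_k B(h_k, h_k) for the positive semidefinite form
   B = gamma E_A + (1 - gamma) E_O. Minimizers are thus characterised by the
   normal equations K b_k = M_k, k >= 0, where b_k = int phi_k(t) beta(t, .) dt.
   Their solutions differ by functions whose b_k all lie in Ker K, and expanding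
   along the eigenfunctions psi_l forces <b_k, psi_l> to be the coefficient
   c_{k,l}. Degeneracy of B on Ker K makes M_k orthogonal to Ker K, so
   square-summability of c is also sufficient for a solution to exist. *)

(** * Square-integrable functions *)

(** Since 1 - gamma may be negative, [B] is not visibly positive. It is so because the noise enters
    E_A and E_O equally, with total weight gamma + (1 - gamma) = 1, while O has no shift: B(h, h) =
    gamma kernel_form A (S* h) + kernel_form eps (S* h). Sharpness on the shift set concerns
    infinitely many h_k, whose squared norms are not summable; hence only finite partial sums of the
    risk are compared with an element of the set close to sqrt(gamma) A. The sum over k decouples
    the minimization: adding t phi_k (x) v to beta moves h_k alone, and the other terms, whose sum
    is finite, cancel. All computations are on representatives, so equations in H^p are proved by
    testing against every vector, and symmetry of K is the tool for moving K to the test vector. A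
    random element is treated as a kernel on Omega x [T1, T2]: its scores, its covariance operator
    and the regression term of the risk then all come from one kind of integral operator and its
    adjoint. *)

Section Lfun2.
Context (R : realType) (d : measure_display) (T : measurableType d).
Variable mu : {measure set T -> \bar R}.

Lemma Lfun2P (f : T -> R) : measurable_fun setT f ->
  (\int[mu]_t (f t ^+ 2)%:E < +oo)%E -> f \in Lfun mu 2%:E.
Proof.
move=> mf fy; rewrite inE; apply/andP; split; rewrite inE//=.
rewrite /finite_norm unlock /Lnorm; apply: poweR_lty.
rewrite (eq_integral (fun t => (f t ^+ 2)%:E))// => t _ /=.
by rewrite powR_mulrn// real_normK ?num_real.
Qed.

Lemma measurable_Lfun2 (f : LfunType mu (@lee1n R 2)) : measurable_fun setT f.
Proof. exact: measurable_funPT. Qed.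

Lemma Lfun2_sqr_lty (f : LfunType mu (@lee1n R 2)) :
  (\int[mu]_t (f t ^+ 2)%:E < +oo)%E.
Proof.
exact: integrable_lty (Lfun2_integrable_sqr (LfunP f)).
Qed.

Definition mkLfun2 (f : T -> R) (mf : measurable_fun setT f)
    (fy : (\int[mu]_t (f t ^+ 2)%:E < +oo)%E) : LfunType mu (@lee1n R 2) :=
  Lfun_Sub (@lee1n R 2) (Lfun2P mf fy).

End Lfun2.

Section L2basics.
Context (R : realType) (d : measure_display) (T : measurableType d).
Variables (mu : {measure set T -> \bar R}) (k : nat).
Implicit Types f g h : L2 mu k.

Lemma dotL2E f : ((dotL2 f f)%:E = \sum_(i < k) \int[mu]_t (f i t ^+ 2)%:E)%E.
Proof.
rewrite /dotL2 -sumEFin; apply: eq_bigr => i _.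
rewrite /Rintegral fineK; first by apply: eq_integral => t _; rewrite expr2.
exact/integrable_fin_num/L2_integrableM.
Qed.

Lemma dotL2Nl f g : dotL2 (- f) g = - dotL2 f g.
Proof. by rewrite -scaleN1r dotL2Zl mulN1r. Qed.

Lemma dotL2Nr f g : dotL2 f (- g) = - dotL2 f g.
Proof. by rewrite dotL2C dotL2Nl dotL2C. Qed.

Lemma dotL2Bl f g h : dotL2 (f - g) h = dotL2 f h - dotL2 g h.
Proof. by rewrite dotL2Dl dotL2Nl. Qed.

Lemma dotL2Br f g h : dotL2 f (g - h) = dotL2 f g - dotL2 f h.
Proof. by rewrite dotL2Dr dotL2Nr. Qed.

Lemma dotL20l f : dotL2 0 f = 0.
Proof. by rewrite -(subrr f) dotL2Bl subrr. Qed.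

Lemma dotL20r f : dotL2 f 0 = 0.
Proof. by rewrite dotL2C dotL20l. Qed.

Lemma dotL2_suml I (r : seq I) (Q : pred I) (F : I -> L2 mu k) g :
  dotL2 (\sum_(i <- r | Q i) F i) g = \sum_(i <- r | Q i) dotL2 (F i) g.
Proof.
by elim/big_rec2 : _ => [|i y x _ <-]; rewrite ?dotL20l ?dotL2Dl.
Qed.

Lemma normL2_ge0 f : 0 <= normL2 f.
Proof. exact: sqrtr_ge0. Qed.

Lemma normL2_sqr f : normL2 f ^+ 2 = dotL2 f f.
Proof. by rewrite sqr_sqrtr// dotL2_ge0. Qed.

Lemma normL2B_sqr f g :
  normL2 (f - g) ^+ 2 = normL2 f ^+ 2 - 2 * dotL2 f g + normL2 g ^+ 2.
Proof. rewrite !normL2_sqr dotL2Bl !dotL2Br (dotL2C g f); ring. Qed.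

Lemma normL2_distC f g : normL2 (f - g) = normL2 (g - f).
Proof. by rewrite -normL2N opprB. Qed.

Lemma ler_normL2_dot f g : `|dotL2 f g| <= normL2 f * normL2 g.
Proof.
rewrite ler_norml dotL2_le_norm andbT lerNl -dotL2Nl -(normL2N f).
exact: dotL2_le_norm.
Qed.

Lemma eqL2_normP f g : eqL2 f g <-> normL2 (f - g) = 0.
Proof.
have E : (normL2 (f - g) = 0) <-> (dotL2 (f - g) (f - g) = 0).
  split; first by rewrite -normL2_sqr => ->; rewrite expr0n.
  by rewrite /normL2 => ->; rewrite sqrtr0.
apply: (iff_trans _ (iff_sym E)); split => [fg|fg0].
  apply/EFin_inj; rewrite dotL2E big1// => i _.
  rewrite (ae_eq_integral (cst 0)%E)//; first by rewrite integral0.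
    apply/measurable_EFinP; apply: measurable_funX; exact: measurable_Lfun2.
  have := fg i; apply: filterS => t E' _ /=.
  by rewrite L2D L2N E' subrr expr0n.
have /eqP := dotL2E (f - g); rewrite fg0 eq_sym seq_psume_eq0; last by
  move=> i _; apply: integral_ge0 => t _; rewrite lee_fin sqr_ge0.
move=> /allP H i.
have /eqP := H i (mem_index_enum _).
move=> /= Hi.
have mF : measurable_fun setT (fun t => (((f - g) i t) ^+ 2)%:E).
  apply/measurable_EFinP; apply: measurable_funX; exact: measurable_Lfun2.
have /(ae_eq_integral_abs mu measurableT mF) :
    (\int[mu]_(x in [set: T]) `|(((f - g) i x) ^+ 2)%:E| = 0)%E.
  rewrite -[RHS]Hi; apply: eq_integral => t _.
  by rewrite gee0_abs// lee_fin sqr_ge0.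
apply: filterS => t /(_ I)/= [] /eqP.
by rewrite sqrf_eq0 L2D L2N subr_eq0 => /eqP.
Qed.

End L2basics.

(** * Completeness of L^2 (Riesz-Fischer) *)

Section Lfun2_complete.
Context (R : realType) (d : measure_display) (T : measurableType d).
Variable mu : {measure set T -> \bar R}.
Local Notation LT := (LfunType mu (@lee1n R 2)).

Lemma ge0_integral_lty_ae (f : T -> \bar R) : measurable_fun setT f ->
  (forall t, 0 <= f t)%E -> (\int[mu]_t f t < +oo)%E ->
  {ae mu, forall t, f t \is a fin_num}.
Proof.
move=> mf f0 fy.
have /integrable_ae : mu.-integrable setT f.
  apply/integrableP; split => //.
  by rewrite (eq_integral f)// => t _; rewrite gee0_abs.
by move=> /(_ measurableT); apply: filterS => t; apply.
Qed.

Lemma measurable_sqrB (f g : LT) :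
  measurable_fun setT (fun t => ((f t - g t) ^+ 2)%:E).
Proof.
by apply/measurable_EFinP/measurable_funX/measurable_funB;
  exact: measurable_Lfun2.
Qed.

(** The increments are at most sqrt(C) 2^-j, so the telescoping series converges absolutely. *)
Lemma cvg_fast_real (v : nat -> R) (C : R) :
  (forall j, 4 ^+ j * (v j.+1 - v j) ^+ 2 <= C) -> cvgn v.
Proof.
move=> vC.
have C0 : 0 <= C by rewrite (le_trans _ (vC 0%N))// mulr_ge0// sqr_ge0.
have dC j : `|v j.+1 - v j| <= Num.sqrt C * 2^-1 ^+ j.
  have s0 : 0 <= Num.sqrt C by exact: sqrtr_ge0.
  rewrite exprVn ler_pdivlMr ?exprn_gt0// -ler_sqr ?nnegrE ?mulr_ge0 ?exprn_ge0//.
  rewrite sqr_sqrtr// exprMn real_normK ?num_real// mulrC -exprM mulnC exprM.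
  by rewrite (_ : 2 ^+ 2 = 4)//; rewrite -natrX.
have : cvgn (series (telescope v)).
  apply: normed_cvg; apply: (@series_le_cvg _ _ (geometric (Num.sqrt C) 2^-1)).
  - by move=> n; rewrite normr_ge0.
  - by move=> n; rewrite /geometric /= mulr_ge0 ?sqrtr_ge0 ?exprn_ge0.
  - by move=> n; exact: dC.
  - by apply: is_cvg_geometric_series; rewrite ger0_norm//; lra.
rewrite telescopeK => cv.
have -> : v = (fun n => (v n - v 0%N) + v 0%N).
  by apply/funext => n; rewrite subrK.
by apply: is_cvgD => //; exact: is_cvg_cst.
Qed.

(** The weighted sum [G] of the squared increments has integral at most the sum of the (4 / 8)^j, so
    it is finite almost everywhere; there [cvg_fast_real] applies with C = G t. *)
Lemma ae_cvg_fast (v : nat -> LT) :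
  (forall j, \int[mu]_t ((v j.+1 t - v j t) ^+ 2)%:E <= (8^-1 ^+ j)%:E)%E ->
  {ae mu, forall t, cvgn (v ^~ t)}.
Proof.
move=> v8.
pose G t := (\sum_(j <oo) (4 ^+ j * (v j.+1 t - v j t) ^+ 2)%:E)%E.
have G0 j t : (0 <= (4 ^+ j * (v j.+1 t - v j t) ^+ 2)%:E)%E.
  by rewrite lee_fin mulr_ge0// sqr_ge0.
have mG j : measurable_fun setT
    (fun t => (4 ^+ j * (v j.+1 t - v j t) ^+ 2)%:E).
  apply/measurable_EFinP/measurable_funM => //.
  exact/measurable_EFinP/measurable_sqrB.
have : (\int[mu]_t G t < +oo)%E.
  rewrite integral_nneseries// (@le_lt_trans _ _ (\sum_(j <oo) (2^-1 ^+ j)%:E)%E)//.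
    apply: lee_nneseries => [j _ _|j _]; first by rewrite integral_ge0.
    under eq_integral do rewrite EFinM.
    rewrite ge0_integralZl//; last 2 first.
      exact: measurable_sqrB.
      by move=> t _; rewrite lee_fin sqr_ge0.
    rewrite (@le_trans _ _ ((4 ^+ j)%:E * (8^-1 ^+ j)%:E)%E)//.
      by apply: lee_wpmul2l => //; rewrite lee_fin exprn_ge0.
    by rewrite -EFinM -exprMn lee_fin (_ : 4 / 8 = 2^-1)//; field.
  have h : series (geometric 1 2^-1 : R^nat) @ \oo --> (1 * (1 - 2^-1)^-1 : R).
    by apply: cvg_geometric_series; rewrite ger0_norm//; lra.
  have -> : (\sum_(j <oo) (2^-1 ^+ j)%:E)%E = (1 * (1 - 2^-1)^-1)%:E :> \bar R.
    apply/cvg_lim => //; rewrite (_ : (fun n => _) =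
      (EFin \o series (geometric 1 2^-1))).
      by apply: cvg_EFin => //; exact: nearW.
    apply/funext => n; rewrite /= /series/= -sumEFin; apply: eq_bigr => i _.
    by rewrite mul1r.
  by rewrite ltry.
have mGG : measurable_fun setT G.
  by apply: ge0_emeasurable_sum => // j t _ _; exact: G0.
have GG0 t : (0 <= G t)%E by apply: nneseries_ge0 => j _ _; exact: G0.
move=> /(ge0_integral_lty_ae mGG GG0); apply: filterS => t.
move=> Gfin; apply: (@cvg_fast_real _ (fine (G t))) => j.
rewrite -lee_fin fineK// /G (@nneseriesD1 _ _ j xpredT)// leeDl//.
by apply: nneseries_ge0 => *; exact: G0.
Qed.

(** A fast subsequence converges almost everywhere, and Fatou's lemma turns the Cauchy bounds into
    bounds on the distance to its limit. *)
Lemma Lfun2_complete (u : nat -> LT) :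
  (forall e, 0 < e -> exists N, forall n m, (N <= n)%N -> (N <= m)%N ->
    (\int[mu]_t ((u n t - u m t) ^+ 2)%:E <= e%:E)%E) ->
  exists f : LT, forall e, 0 < e -> exists N, forall n, (N <= n)%N ->
    (\int[mu]_t ((u n t - f t) ^+ 2)%:E <= e%:E)%E.
Proof.
move=> cu.
have /choice [N NP] : forall j : nat, exists N, forall n m,
    (N <= n)%N -> (N <= m)%N ->
    (\int[mu]_t ((u n t - u m t) ^+ 2)%:E <= (8^-1 ^+ j)%:E)%E.
  by move=> j; apply: cu; rewrite exprn_gt0.
(* Summing the [N i] gives a nondecreasing sequence above [N]; the summand [j] sends it to
   infinity. *)
pose nn j := (\sum_(i < j.+1) N i + j)%N.
have nnN j : (N j <= nn j)%N by rewrite /nn big_ord_recr/= addnAC leq_addl.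
have nn_le j : (nn j <= nn j.+1)%N.
  by rewrite /nn [in leqRHS]big_ord_recr/= leq_add// leq_addr.
have nn_ge j : (j <= nn j)%N by rewrite /nn leq_addl.
clearbody nn.
have := @ae_cvg_fast (fun j => u (nn j)).
case=> [j|Z [mZ Z0 cvZ]].
  by apply: NP => //; exact: leq_trans (nnN j) (nn_le j).
(* Cutting off on the null set [Z] makes the sequence converge at every point, so that its limit is
   measurable. *)
pose w j t := u (nn j) t * \1_(~` Z) t.
pose f t := limn (w ^~ t).
have wf t : w ^~ t @ \oo --> f t.
  have [tZ|tZ] := pselect (Z t).
    rewrite /f (_ : w ^~ t = cst 0); last first.
      by apply/funext => j; rewrite /w indicE/= memNset ?mulr0//=; apply.
    exact: is_cvg_cst.
  have -> : w ^~ t = (fun j => u (nn j) t).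
    by apply/funext => j; rewrite /w indicE/= mem_set ?mulr1.
  rewrite /f (_ : w ^~ t = (fun j => u (nn j) t)); last first.
    by apply/funext => j; rewrite /w indicE/= mem_set ?mulr1.
  by apply: contrapT => h; apply: tZ; apply: cvZ.
have mw j : measurable_fun setT (w j).
  apply: measurable_funM; first exact: measurable_Lfun2.
  by apply: measurable_indic; exact: measurableC.
have mf : measurable_fun setT f.
  by apply: (measurable_fun_cvg mw) => t _; exact: wf.
have wu n j : (\int[mu]_t ((u n t - w j t) ^+ 2)%:E =
               \int[mu]_t ((u n t - u (nn j) t) ^+ 2)%:E)%E.
  apply: ge0_ae_eq_integral => //=.
  - apply/measurable_EFinP/measurable_funX/measurable_funB => //.
  - exact: measurable_sqrB.
  - by move=> t _; rewrite lee_fin sqr_ge0.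
  - by move=> t _; rewrite lee_fin sqr_ge0.
  exists Z; split => // t /= /not_implyP[_]; apply: contra_notP => tZ.
  by rewrite /w indicE/= mem_set ?mulr1.
have fatu n : (\int[mu]_t ((u n t - f t) ^+ 2)%:E <=
    limn_einf (fun j => \int[mu]_t ((u n t - u (nn j) t) ^+ 2)%:E))%E.
  rewrite -(_ : (fun j => \int[mu]_t ((u n t - w j t) ^+ 2)%:E)%E =
    (fun j => \int[mu]_t ((u n t - u (nn j) t) ^+ 2)%:E)%E); last first.
    by apply/funext => j; exact: wu.
  rewrite (eq_integral (fun t =>
      limn_einf (fun j => ((u n t - w j t) ^+ 2)%:E))); last first.
    move=> t _; apply/esym.
    have h : (fun j => ((u n t - w j t) ^+ 2)%:E) @ \oo -->
        ((u n t - f t) ^+ 2)%:E.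
      apply: cvg_EFin; first exact: nearW.
      rewrite (_ : _ \o _ = (fun j => (u n t - w j t) * (u n t - w j t))).
        by rewrite expr2; apply: cvgM; (apply: cvgB; [exact: cvg_cst|exact: wf]).
      by apply/funext => j /=; rewrite expr2.
    by rewrite is_cvg_limn_einfE; [exact/cvg_lim|apply/cvg_ex; eexists; exact: h].
  apply: fatou => //.
    move=> j; apply/measurable_EFinP/measurable_funX/measurable_funB => //.
  by move=> j t _; rewrite lee_fin sqr_ge0.
have ful e : 0 < e -> exists N, forall n, (N <= n)%N ->
    (\int[mu]_t ((u n t - f t) ^+ 2)%:E <= e%:E)%E.
  move=> e0; have [M MP] := cu _ e0.
  exists M => n Mn; apply: (le_trans (fatu n)).
  rewrite limn_einf_lim; apply: lime_le; first exact: is_cvg_einfs.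
  exists M => // j /= Mj.
  apply: (@le_trans _ _ (\int[mu]_t ((u n t - u (nn j) t) ^+ 2)%:E)%E); last first.
    by apply: MP => //; exact: leq_trans Mj (nn_ge j).
  by apply: ereal_inf_lbound; exists j => /=.
have fy : (\int[mu]_t (f t ^+ 2)%:E < +oo)%E.
  have [M MP] := ful _ ltr01.
  have m1 : measurable_fun setT (fun t => ((u M t - f t) ^+ 2)%:E).
    apply/measurable_EFinP/measurable_funX/measurable_funB => //.
  have m2 : measurable_fun setT (fun t => ((u M t) ^+ 2)%:E).
    apply/measurable_EFinP/measurable_funX; exact: measurable_Lfun2.
  apply: (@le_lt_trans _ _
      (\int[mu]_t (2%:E * (((u M t - f t) ^+ 2)%:E + ((u M t) ^+ 2)%:E)))%E).
    apply: ge0_le_integral => //.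
    - by move=> t _; rewrite lee_fin sqr_ge0.
    - by apply/measurable_EFinP/measurable_funX.
    - by apply: emeasurable_funM => //; exact: emeasurable_funD.
    - move=> t _; rewrite -EFinD -EFinM lee_fin.
      by rewrite -subr_ge0 (_ : _ - _ = (f t - 2 * u M t) ^+ 2) ?sqr_ge0//; ring.
  rewrite ge0_integralZl//; last 2 first.
    exact: emeasurable_funD.
    by move=> t _; rewrite adde_ge0// lee_fin sqr_ge0.
  rewrite lte_mul_pinfty// ge0_integralD//.
  - rewrite lte_add_pinfty//; first exact: le_lt_trans (MP M (leqnn _)) (ltry _).
    exact: Lfun2_sqr_lty.
  - by move=> t _; rewrite lee_fin sqr_ge0.
  - by move=> t _; rewrite lee_fin sqr_ge0.
exists (mkLfun2 mf fy) => e /ful[M MP]; exists M => n /MP.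
by rewrite /mkLfun2.
Qed.

End Lfun2_complete.

(** * Convergence in L^2(mu)^k and the Riesz representation *)

Section L2cvg.
Context (R : realType) (d : measure_display) (T : measurableType d).
Variables (mu : {measure set T -> \bar R}) (k : nat).
Implicit Types (f g h : L2 mu k) (u : nat -> L2 mu k).

Lemma cvgL2P u f : u @ \oo --> f <->
  forall e, 0 < e -> exists N, forall n, (N <= n)%N -> normL2 (u n - f) < e.
Proof.
split=> [/cvg_ballP uf e e0|uf].
  have [N _ NP] := uf e e0; exists N => n Nn.
  by rewrite normL2_distC; exact: NP.
apply/cvg_ballP => e e0.
have [N NP] := uf e e0.
exists N; first by [].
move=> n Nn.
by change (normL2 (f - u n) < e); rewrite normL2_distC; exact: NP.
Qed.

Lemma cvgL2_dotl u f g : u @ \oo --> f ->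
  dotL2 (u n) g @[n --> \oo] --> dotL2 f g.
Proof.
move=> /cvgL2P uf; apply/cvgrPdist_lt => e e0.
have g1 : 0 < normL2 g + 1 by rewrite ltr_wpDl ?normL2_ge0.
have [N NP] := uf _ (divr_gt0 e0 g1).
exists N => // n /= /NP; rewrite ltr_pdivlMr// => h.
rewrite distrC -dotL2Bl (le_lt_trans (ler_normL2_dot _ _))//.
by rewrite (le_lt_trans _ h)// ler_wpM2l ?normL2_ge0 ?lerDl.
Qed.

Lemma cvgL2_sqr u f : u @ \oo --> f ->
  dotL2 (u n) (u n) @[n --> \oo] --> dotL2 f f.
Proof.
move=> uf.
have -> : (fun n => dotL2 (u n) (u n)) = (fun n =>
    normL2 (u n - f) * normL2 (u n - f) + 2 * dotL2 (u n) f - dotL2 f f).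
  by apply/funext => n; rewrite -expr2 normL2B_sqr !normL2_sqr; ring.
have h : normL2 (u n - f) @[n --> \oo] --> 0.
  apply/cvgr0Pnorm_lt => e e0; move/cvgL2P : uf => /(_ e e0)[N NP].
  by exists N => // n /= /NP; rewrite ger0_norm// normL2_ge0.
rewrite [X in _ --> X](_ : _ = 0 * 0 + 2 * dotL2 f f - dotL2 f f); last by ring.
apply: cvgB; last exact: cvg_cst.
apply: cvgD; first exact: cvgM.
by apply: cvgMr; exact: cvgL2_dotl.
Qed.

Lemma eqL2_dotl f g h : eqL2 f g -> dotL2 f h = dotL2 g h.
Proof.
move=> /eqL2_normP fg; apply/eqP; rewrite -subr_eq0 -dotL2Bl -normr_le0.
by rewrite (le_trans (ler_normL2_dot _ _))// fg mul0r.
Qed.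

Lemma eqL2_refl f : eqL2 f f.
Proof. by move=> i; exact: filterE. Qed.

Lemma eqL2_sym f g : eqL2 f g -> eqL2 g f.
Proof. by move=> fg i; have := fg i; apply: filterS => t ->. Qed.

(** Duality form of [eqL2], by taking h = f - g. Many identities between representatives below are
    proved through it. *)
Lemma eqL2_dotP f g : (forall h, dotL2 f h = dotL2 g h) <-> eqL2 f g.
Proof.
split => [fg|fg h]; last exact: eqL2_dotl.
by apply/eqL2_normP; rewrite /normL2 dotL2Bl fg subrr sqrtr0.
Qed.

Lemma L2_complete u :
  (forall e, 0 < e -> exists N, forall n m, (N <= n)%N -> (N <= m)%N ->
    dotL2 (u n - u m) (u n - u m) <= e) ->
  exists f, u @ \oo --> f.
Proof.
move=> cu.
have /choice[F FP] : forall i : 'I_k, exists f : LfunType mu (@lee1n R 2),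
    forall e, 0 < e -> exists N, forall n, (N <= n)%N ->
    (\int[mu]_t ((u n i t - f t) ^+ 2)%:E <= e%:E)%E.
  move=> i; apply: (@Lfun2_complete _ _ _ _ (fun n => u n i)) => e /cu[N NP].
  exists N => n m Nn Nm; have := NP _ _ Nn Nm; rewrite -lee_fin; apply: le_trans.
  rewrite dotL2E (bigD1 i)//= (@eq_integral _ _ _ _ _
    (fun t => (((u n - u m) i t) ^+ 2)%:E)); last by move=> t _; rewrite L2D L2N.
  rewrite leeDl// sume_ge0// => j _; apply: integral_ge0 => t _.
  by rewrite lee_fin sqr_ge0.
exists [ffun i => F i]; apply/cvgL2P => e e0.
(* The k coordinates together then cost k e^2 / (k + 1) < e^2, also when k = 0. *)
have e2 : 0 < e ^+ 2 / k.+1%:R by rewrite divr_gt0// exprn_gt0.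
have /choice[N NP] := fun i => FP i _ e2.
exists (\max_i N i)%N => n Nn.
have : dotL2 (u n - [ffun i => F i]) (u n - [ffun i => F i]) < e ^+ 2.
  rewrite -lte_fin dotL2E.
  apply: (@le_lt_trans _ _ (\sum_(i < k) (e ^+ 2 / k.+1%:R)%:E)%E).
    apply: lee_sum => i _.
    rewrite (_ : (\int[mu]_t _)%E = (\int[mu]_t ((u n i t - F i t) ^+ 2)%:E)%E).
      by apply: NP; rewrite (leq_trans _ Nn)// leq_bigmax.
    by apply: eq_integral => t _; rewrite L2D L2N ffunE.
  rewrite sumEFin lte_fin sumr_const card_ord -[ltLHS]mulr_natr mulrAC.
  by rewrite ltr_pdivrMr// ltr_pM2l ?exprn_gt0// ltr_nat.
rewrite -normL2_sqr ltr_sqr// ?nnegrE ?normL2_ge0// ltW//.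
Qed.

(** First-order condition without derivatives. It serves for the Riesz representation, for null
    vectors of a positive form and for the minimizers of the risk. *)
Lemma quad_ge0_eq0 (a b : R) : (forall t, 0 <= a * t ^+ 2 + 2 * b * t) -> b = 0.
Proof.
move=> H; apply/eqP; rewrite -sqrf_eq0 -normr_le0 ger0_norm ?sqr_ge0//.
have a1 : 0 < `|a| + 1 by rewrite ltr_wpDl.
(* The vertex -b/a of the parabola, with |a| + 1 in place of [a] to exclude a zero denominator. *)
have := H (- b / (`|a| + 1)).
have -> : a * (- b / (`|a| + 1)) ^+ 2 + 2 * b * (- b / (`|a| + 1)) =
    (b ^+ 2 / (`|a| + 1)) * (a / (`|a| + 1) - 2) by field; rewrite gt_eqF.
have h1 : a / (`|a| + 1) - 2 < 0.
  by rewrite subr_lt0 ltr_pdivrMr//; have := ler_norm a; have := normr_ge0 a; lra.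
by rewrite nmulr_lge0// pmulr_lle0 ?invr_gt0.
Qed.

(** The representative is found as a minimizer of J f = |f|^2 - 2 L f: the parallelogram law makes a
    minimizing sequence Cauchy, and the first-order condition at the limit is L f = <f, g>. *)
Lemma L2_riesz (L : L2 mu k -> R) (M : R) :
  (forall a f g, L (a *: f + g) = a * L f + L g) ->
  (forall f, `|L f| <= M * normL2 f) ->
  exists g, forall f, L f = dotL2 f g.
Proof.
move=> lL bL.
have LD f g : L (f + g) = L f + L g by rewrite -[f]scale1r lL mul1r scale1r.
have L0 : L 0 = 0 by have := LD 0 0; rewrite addr0; lra.
have LZ a f : L (a *: f) = a * L f by rewrite -[_ *: _]addr0 lL L0 addr0.
have LB f g : L (f - g) = L f - L g by rewrite -scaleN1r LD LZ mulN1r.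
pose J f := dotL2 f f - 2 * L f.
have Jlb f : - M ^+ 2 <= J f.
  rewrite /J -normL2_sqr; have := bL f; have := ler_norm (L f) => h1 h2.
  by have := sqr_ge0 (normL2 f - M); rewrite sqrrB -mulr_natr; nra.
pose m := inf (range J).
have infJ : has_inf (range J).
  by split; [exists (J 0), 0|exists (- M ^+ 2) => _ [f _ <-]].
have mJ f : m <= J f by apply: inf_lbound; [case: infJ|exists f].
have /choice[u uP] : forall n : nat, exists f, J f < m + n.+1%:R^-1.
  move=> n; have n0 : 0 < n.+1%:R^-1 :> R by rewrite invr_gt0.
  have [_ [f _ <-] fP] := inf_adherent n0 infJ.
  by exists f.
have parL f g : dotL2 (f - g) (f - g) =
    2 * J f + 2 * J g - 4 * J (2^-1 *: (f + g)).
  rewrite /J LZ LD !dotL2Zl !dotL2Zr dotL2Bl !dotL2Br !dotL2Dl !dotL2Dr.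
  by rewrite (dotL2C g f); field.
have [g ug] : exists g, u @ \oo --> g.
  (* Beyond this index 1/(n + 1) <= e/4, so both values of J are within e/4 of the infimum, and
     [parL] gives at most 2 (e/4) + 2 (e/4) = e. *)
  apply: L2_complete => e e0; exists (Num.truncn (4 / e)) => i j Ni Nj.
  rewrite parL.
  have aux n : (Num.truncn (4 / e) <= n)%N -> n.+1%:R^-1 <= e / 4.
    move=> Nn; rewrite -[leRHS]invrK lef_pV2 ?posrE ?invr_gt0 ?divr_gt0//.
    by rewrite invf_div (le_trans (ltW (truncnS_gt _)))// ler_nat ltnS.
  have := mJ (2^-1 *: (u i + u j)).
  move: (uP i) (uP j) (aux _ Ni) (aux _ Nj).
  move: (J (u i)) (J (u j)) (J _) => a b c'.
  by move: i.+1%:R^-1 j.+1%:R^-1 => x y; clearbody m; clear; lra.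
exists g.
have Jg : J g <= m.
  have Lu : L (u n) @[n --> \oo] --> L g.
    apply/cvgrPdist_lt => e e0.
    have M1 : 0 < `|M| + 1 by rewrite ltr_wpDl.
    have [N NP] := (cvgL2P u g).1 ug _ (divr_gt0 e0 M1).
    exists N => // n /= /NP; rewrite ltr_pdivlMr// => h.
    rewrite distrC -LB (le_lt_trans (bL _))// (le_lt_trans _ h)// mulrC.
    rewrite ler_wpM2l ?normL2_ge0//.
    by have := ler_norm M; have := normr_ge0 M; lra.
  have Ju : J (u n) @[n --> \oo] --> J g.
    apply: cvgB; first exact: cvgL2_sqr.
    by apply: cvgMr.
  have mn : m + n.+1%:R^-1 @[n --> \oo] --> m + 0.
    by apply: cvgD; [exact: cvg_cst|exact: cvg_harmonic].
  rewrite -[leRHS]addr0 -(cvg_lim (@Rhausdorff R) mn) -(cvg_lim (@Rhausdorff R) Ju).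
  apply: ler_lim; [by apply/cvg_ex; eexists; exact: Ju|
    by apply/cvg_ex; eexists; exact: mn|].
  by apply: nearW => n; exact/ltW/uP.
move=> f; apply/eqP; rewrite eq_sym -subr_eq0; apply/eqP.
apply: (@quad_ge0_eq0 (dotL2 f f)) => t.
have := le_trans Jg (mJ (g + t *: f)).
by rewrite /J LD LZ dotL2Dl !dotL2Dr !dotL2Zl !dotL2Zr (dotL2C g f); lra.
Qed.

End L2cvg.

(** * Orthogonal series *)

Section orthogonal.
Context (R : realType) (d : measure_display) (T : measurableType d).
Variables (mu : {measure set T -> \bar R}) (k : nat).
Implicit Types (f g h : L2 mu k) (x e : nat -> L2 mu k).

(** Pythagoras. An arbitrary duplicate-free list covers both initial partial sums and differences of
    two of them. *)
Lemma sqr_orthogonal_sum x (r : seq nat) :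
  (forall i j, i != j -> dotL2 (x i) (x j) = 0) -> uniq r ->
  dotL2 (\sum_(i <- r) x i) (\sum_(i <- r) x i) =
  \sum_(i <- r) dotL2 (x i) (x i).
Proof.
move=> ox; elim: r => [|i r ih] /=; first by rewrite !big_nil dotL20l.
case/andP => ir ur.
have S0 : dotL2 (\sum_(j <- r) x j) (x i) = 0.
  rewrite dotL2_suml big_seq big1// => j jr; apply: ox.
  by apply: contraNneq ir => <-.
rewrite !big_cons dotL2Dl !dotL2Dr ih// (dotL2C (x i) (\sum_(j <- r) x j)).
by rewrite S0 addr0 add0r.
Qed.

(** By Pythagoras the squared distance of two partial sums is the increment of a bounded
    nondecreasing real sequence. *)
Lemma orthogonal_series_cvg x (M : R) :
  (forall i j, i != j -> dotL2 (x i) (x j) = 0) ->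
  (forall n, \sum_(i < n) dotL2 (x i) (x i) <= M) ->
  exists f, (\sum_(i < n) x i) @[n --> \oo] --> f.
Proof.
move=> ox bM; apply: L2_complete => e e0.
pose s n := \sum_(i < n) dotL2 (x i) (x i).
have snd : nondecreasing_seq s.
  apply/nondecreasing_seqP => n; rewrite /s big_ord_recr lerDl.
  exact: dotL2_ge0.
have cs : cvgn s.
  apply: nondecreasing_is_cvgn => //.
  by exists M => _ [n _ <-]; exact: bM.
have H i j : (i <= j)%N ->
    dotL2 (\sum_(l < j) x l - \sum_(l < i) x l)
          (\sum_(l < j) x l - \sum_(l < i) x l) = s j - s i.
  have D (V : zmodType) (F : nat -> V) : (i <= j)%N ->
      \sum_(l < j) F l - \sum_(l < i) F l = \sum_(i <= l < j) F l.
    move=> ij; rewrite -!(big_mkord xpredT) (@big_cat_nat _ _ _ i 0 j)//=.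
    by rewrite addrAC subrr add0r.
  move=> ij; rewrite /s !D// sqr_orthogonal_sum ?iota_uniq//; apply/esym.
  exact: (D R (fun l => dotL2 (x l) (x l))) ij.
have /cvgrPdist_lt : s @ \oo --> limn s by exact: cs.
have e20 : 0 < e / 2 by rewrite divr_gt0.
move=> /(_ _ e20)[N _ NP]; exists N => i j Ni Nj.
have := NP _ Ni; have := NP _ Nj; rewrite /= => h1 h2.
have h : `|s i - s j| <= e.
  rewrite -(subrKA (limn s)) (le_trans (ler_normD _ _))//.
  by rewrite [X in X + _]distrC; lra.
have [ij|/ltnW ij] := leqP i j.
  rewrite -normL2_sqr normL2_distC normL2_sqr H//.
  by rewrite (le_trans _ h)// distrC ler_norm.
by rewrite H// (le_trans _ h)// ler_norm.
Qed.

Variables (J : set nat) (e : nat -> L2 mu k).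
Hypothesis one : forall l m, J l -> J m -> dotL2 (e l) (e m) = (l == m)%:R.

(** Padding by 0 outside [J] turns the series over [J] into an orthogonal series over all
    indices. *)
Let x (c : nat -> R) l := if l \in J then c l *: e l else 0.

Let xE (c : nat -> R) n :
  \sum_(l < n | (l : nat) \in J) c l *: e l = \sum_(l < n) x c l.
Proof. by rewrite big_mkcond. Qed.

Let ox c i j : i != j -> dotL2 (x c i) (x c j) = 0.
Proof.
move=> ij; rewrite /x; case: ifPn => [/set_mem iJ|_]; last by rewrite dotL20l.
case: ifPn => [/set_mem jJ|_]; last by rewrite dotL20r.
by rewrite dotL2Zl dotL2Zr one// (negbTE ij) !mulr0.
Qed.

Let xx c i : dotL2 (x c i) (x c i) = if i \in J then c i ^+ 2 else 0.
Proof.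
rewrite /x; case: ifPn => [/set_mem iJ|_]; last by rewrite dotL20l.
by rewrite dotL2Zl dotL2Zr one// eqxx mulr1 expr2.
Qed.

Lemma orthonormal_sqr (c : nat -> R) n :
  dotL2 (\sum_(l < n | (l : nat) \in J) c l *: e l)
        (\sum_(l < n | (l : nat) \in J) c l *: e l) =
  \sum_(l < n | (l : nat) \in J) c l ^+ 2.
Proof.
rewrite xE -!(big_mkord xpredT) sqr_orthogonal_sum ?iota_uniq//; last exact: ox.
by rewrite big_mkord [RHS]big_mkcond; apply: eq_bigr => i _; rewrite xx.
Qed.

Lemma orthonormal_dot (c : nat -> R) n m : J m -> (m < n)%N ->
  dotL2 (\sum_(l < n | (l : nat) \in J) c l *: e l) (e m) = c m.
Proof.
move=> Jm mn; rewrite dotL2_suml (bigD1 (Ordinal mn)) ?mem_set//=.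
rewrite dotL2Zl one// eqxx mulr1 big1 ?addr0// => i /andP[/set_mem Ji im].
by rewrite dotL2Zl one// (_ : (i == m :> nat) = false) ?mulr0//; exact/negbTE.
Qed.

Lemma orthonormal_series_dot (c : nat -> R) f m : J m ->
  (\sum_(l < n | (l : nat) \in J) c l *: e l) @[n --> \oo] --> f ->
  dotL2 f (e m) = c m.
Proof.
move=> Jm /(cvgL2_dotl (g := e m)) h.
rewrite -(cvg_lim (@Rhausdorff R) h); apply: cvg_lim => //.
apply: cvg_near_cst; exists m.+1 => // n /= mn; exact: orthonormal_dot.
Qed.

Lemma orthonormal_series_cvg (c : nat -> R) (M : R) :
  (forall n, \sum_(l < n | (l : nat) \in J) c l ^+ 2 <= M) ->
  exists f, (\sum_(l < n | (l : nat) \in J) c l *: e l) @[n --> \oo] --> f.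
Proof.
move=> cM.
rewrite (_ : (fun n => _) = (fun n => \sum_(l < n) x c l)); last first.
  by apply/funext => n; rewrite xE.
apply: (@orthogonal_series_cvg _ M); first exact: ox.
move=> n; rewrite (le_trans _ (cM n))// [leRHS]big_mkcond le_eqVlt.
by apply/orP; left; apply/eqP; apply: eq_bigr => i _; rewrite xx.
Qed.

Lemma bessel f n :
  \sum_(l < n | (l : nat) \in J) dotL2 f (e l) ^+ 2 <= dotL2 f f.
Proof.
pose s := \sum_(l < n | (l : nat) \in J) dotL2 f (e l) *: e l.
have := dotL2_ge0 (f - s).
have ss := orthonormal_sqr (fun l => dotL2 f (e l)) n.
have fs : dotL2 f s = \sum_(l < n | (l : nat) \in J) dotL2 f (e l) ^+ 2.
  rewrite dotL2C dotL2_suml; apply: eq_bigr => l _.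
  by rewrite dotL2Zl dotL2C expr2.
rewrite dotL2Bl !dotL2Br (dotL2C s f) fs -/s in ss *.
by rewrite ss; lra.
Qed.

Lemma parseval f :
  (\sum_(l < n | (l : nat) \in J) dotL2 f (e l) *: e l) @[n --> \oo] --> f ->
  (\sum_(l < n | (l : nat) \in J) dotL2 f (e l) ^+ 2) @[n --> \oo] --> dotL2 f f.
Proof.
move=> h; have := cvgL2_sqr h.
rewrite (_ : (fun n => _) = (fun n =>
  \sum_(l < n | (l : nat) \in J) dotL2 f (e l) ^+ 2)) => [//|].
by apply/funext => n; exact: (orthonormal_sqr (fun l => dotL2 f (e l)) n).
Qed.

End orthogonal.

(** * Partial integrals of kernels on a product *)

Section product_swap.
Context (R : realType) (d1 d2 : measure_display).
Context (T1 : measurableType d1) (T2 : measurableType d2).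
Variable m1 : {sigma_finite_measure set T1 -> \bar R}.
Variable m2 : {sigma_finite_measure set T2 -> \bar R}.
Local Notation m12 := (m1 \x m2)%E.
Local Notation m21 := (m2 \x m1)%E.

Lemma measurable_swap_comp (d' : measure_display) (T' : measurableType d')
    (f : T1 * T2 -> T') : measurable_fun setT f ->
  measurable_fun setT (fun z : T2 * T1 => f (z.2, z.1)).
Proof.
move=> mf; apply: (measurableT_comp mf).
by apply/measurable_fun_pair => /=; [exact: measurable_snd|exact: measurable_fst].
Qed.

Lemma ge0_integral_swap (f : T1 * T2 -> \bar R) : measurable_fun setT f ->
  (forall z, 0 <= f z)%E ->
  (\int[m21]_z f (z.2, z.1) = \int[m12]_z f z)%E.
Proof.
move=> mf f0; rewrite fubini_tonelli1//; last exact: measurable_swap_comp.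
by rewrite (fubini_tonelli2 f).
Qed.

Lemma integrable_swap (f : T1 * T2 -> \bar R) : m12.-integrable setT f ->
  m21.-integrable setT (fun z => f (z.2, z.1)).
Proof.
move=> /integrableP[mf fy].
apply/integrableP; split; first exact: measurable_swap_comp.
have -> // := @ge0_integral_swap (abse \o f) _ _.
- exact: measurableT_comp.
- by move=> z; exact: abse_ge0.
Qed.

Lemma integral_swap (f : T1 * T2 -> \bar R) : m12.-integrable setT f ->
  (\int[m21]_z f (z.2, z.1) = \int[m12]_z f z)%E.
Proof.
move=> imf.
by rewrite -(integral21_prod_meas1 imf) -integral12_prod_meas1//;
  exact: integrable_swap.
Qed.

Lemma swapL_lty (f : LfunType m12 (@lee1n R 2)) :
  (\int[m21]_z ((f (z.2, z.1)) ^+ 2)%:E < +oo)%E.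
Proof.
rewrite (ge0_integral_swap (f := fun z => (f z ^+ 2)%:E)).
- exact: Lfun2_sqr_lty.
- apply/measurable_EFinP/measurable_funX; exact: measurable_Lfun2.
- by move=> z; rewrite lee_fin sqr_ge0.
Qed.

Definition swapL (f : LfunType m12 (@lee1n R 2)) : LfunType m21 (@lee1n R 2) :=
  mkLfun2 (measurable_swap_comp (measurable_Lfun2 f)) (swapL_lty f).

Lemma measurable_tens (f : LfunType m1 (@lee1n R 2)) (g : LfunType m2 (@lee1n R 2)) :
  measurable_fun setT (fun z : T1 * T2 => f z.1 * g z.2).
Proof.
by apply: measurable_funM; apply: measurableT_comp => //; exact: measurable_Lfun2.
Qed.

Lemma tens_lty (f : LfunType m1 (@lee1n R 2)) (g : LfunType m2 (@lee1n R 2)) :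
  (\int[m12]_z ((f z.1 * g z.2) ^+ 2)%:E < +oo)%E.
Proof.
have mf : measurable_fun setT (fun t => (f t ^+ 2)%:E).
  apply/measurable_EFinP/measurable_funX; exact: measurable_Lfun2.
have mg : measurable_fun setT (fun t => (g t ^+ 2)%:E).
  apply/measurable_EFinP/measurable_funX; exact: measurable_Lfun2.
rewrite (fubini_tonelli1 (fun z => ((f z.1 * g z.2) ^+ 2)%:E)); last 2 first.
- apply/measurable_EFinP/measurable_funX; exact: measurable_tens.
- by move=> z; rewrite lee_fin sqr_ge0.
rewrite /fubini_F (eq_integral (fun x => (f x ^+ 2)%:E * \int[m2]_y (g y ^+ 2)%:E)%E).
  rewrite ge0_integralZr//; last 2 first.
  - by move=> t _; rewrite lee_fin sqr_ge0.
  - by apply: integral_ge0 => t _; rewrite lee_fin sqr_ge0.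
  rewrite lte_mul_pinfty ?Lfun2_sqr_lty//.
  + by apply: integral_ge0 => t _; rewrite lee_fin sqr_ge0.
  + by rewrite ge0_fin_numE ?Lfun2_sqr_lty// integral_ge0// => t _; rewrite lee_fin sqr_ge0.
move=> t _ /=; rewrite -ge0_integralZl//; last 2 first.
- by move=> y _; rewrite lee_fin sqr_ge0.
- by rewrite lee_fin sqr_ge0.
by apply: eq_integral => y _; rewrite exprMn.
Qed.

Definition tens_Lfun (f : LfunType m1 (@lee1n R 2)) (g : LfunType m2 (@lee1n R 2)) :
  LfunType m12 (@lee1n R 2) := mkLfun2 (measurable_tens f g) (tens_lty f g).

(** The two factors may live on different spaces, unlike in [tensorL2]; the first one is a
    probability space when scores are studied. *)
Definition tens p (phi : L2 m1 1) (x : L2 m2 p) : L2 m12 p :=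
  [ffun i => tens_Lfun (phi ord0) (x i)].

Lemma tensE p (phi : L2 m1 1) (x : L2 m2 p) i z :
  tens phi x i z = phi ord0 z.1 * x i z.2.
Proof. by rewrite ffunE. Qed.

End product_swap.

Section partial_integral.
Context (R : realType) (d1 d2 : measure_display).
Context (T1 : measurableType d1) (T2 : measurableType d2).
Variable m1 : {finite_measure set T1 -> \bar R}.
Variable m2 : {finite_measure set T2 -> \bar R}.
Local Notation m12 := (m1 \x m2)%E.
Variable p : nat.
Implicit Types (beta : L2 m12 p) (x : L2 m2 p) (phi : L2 m1 1).

(** Fubini makes almost every section of [beta] square-integrable. As [g] agrees with the section at
    every tau, integrals over the section become inner products. *)
Lemma ae_section beta :
  {ae m1, forall t, exists g : L2 m2 p, forall i tau, g i tau = beta i (t, tau)}.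
Proof.
have H i : {ae m1, forall t, exists g : LfunType m2 (@lee1n R 2),
    forall tau, g tau = beta i (t, tau)}.
  have h := Lfun2_integrable_sqr (LfunP (beta i)).
  have := ae_integrable1 h; apply: filterS => t /integrable_lty/= ht.
  have mt : measurable_fun setT (fun tau => beta i (t, tau)).
    apply: measurableT_comp; first exact: measurable_Lfun2.
    exact: pair1_measurable.
  by exists (mkLfun2 mt (ht measurableT)).
have : {ae m1, forall t (i : 'I_p), exists g : LfunType m2 (@lee1n R 2),
    forall tau, g tau = beta i (t, tau)}.
  exact: filter_forall.
apply: filterS => t /choice[g gP].
by exists [ffun i => g i] => i tau; rewrite ffunE.
Qed.


(** [m1] is finite, so the constant 1 is square-integrable and z -> g z.2 is the tensor 1 (x) g. *)
Lemma tensor2_integrable (f : LfunType m12 (@lee1n R 2))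
    (g : LfunType m2 (@lee1n R 2)) :
  m12.-integrable setT (fun z => (f z * g z.2)%:E).
Proof.
pose u : LfunType m1 (@lee1n R 2) :=
  Lfun_Sub (@lee1n R 2) (Lfun_cst m1 1 2).
have := Lfun2_mul_Lfun1 (LfunP f) (LfunP (tens_Lfun u g)).
move=> /Lfun1_integrable; apply: eq_integrable => // z _ /=.
by rewrite mul1r.
Qed.

Lemma pint_integrable beta x :
  m12.-integrable setT (fun z => (\sum_(i < p) beta i z * x i z.2)%:E).
Proof.
apply: (@eq_integrable _ _ _ m12 _ measurableT
  (fun z => (\sum_(i < p) (beta i z * x i z.2)%:E)%E)).
  by move=> z _; rewrite sumEFin.
by apply: integrable_sum => // i _; exact: tensor2_integrable.
Qed.

(** The integral operator with kernel [beta]: the regression term of the risk when [x] is the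
    covariate, and a random variable when [beta] is a random element seen as a kernel. *)
Definition pint beta x (t : T1) : R :=
  \int[m2]_tau (\sum_(i < p) beta i (t, tau) * x i tau).

Lemma measurable_pint beta x : measurable_fun setT (pint beta x).
Proof.
have := measurable_fubini_F (pint_integrable beta x).
by apply: measurableT_comp; exact: fine_measurable.
Qed.

Lemma Rintegral_sumM (g x : L2 m2 p) :
  \int[m2]_tau (\sum_(i < p) g i tau * x i tau) = dotL2 g x.
Proof.
rewrite /dotL2 /Rintegral.
under eq_integral do rewrite -sumEFin.
rewrite integral_sum//; last by move=> i; exact: L2_integrableM.
rewrite -sum_fine// => i _; apply: integrable_fin_num => //.
exact: L2_integrableM.
Qed.

Lemma pint_section beta x t (g : L2 m2 p) :
  (forall i tau, g i tau = beta i (t, tau)) -> pint beta x t = dotL2 g x.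
Proof.
move=> gE; rewrite -Rintegral_sumM; apply: eq_Rintegral => tau _.
by apply: eq_bigr => i _; rewrite gE.
Qed.

(** Cauchy-Schwarz on each section bounds the integrand by F t |x|^2, and Tonelli makes [F]
    integrable. *)
Lemma pint_lty beta x : (\int[m1]_t (pint beta x t ^+ 2)%:E < +oo)%E.
Proof.
have mb i : measurable_fun setT (fun z => ((beta i z) ^+ 2)%:E).
  apply/measurable_EFinP/measurable_funX; exact: measurable_Lfun2.
have b0 i z : (0 <= ((beta i z) ^+ 2)%:E)%E by rewrite lee_fin sqr_ge0.
pose F t := (\sum_(i < p) \int[m2]_tau ((beta i (t, tau)) ^+ 2)%:E)%E.
have mF : measurable_fun setT F.
  apply: emeasurable_sum => i.
  exact: (measurable_fun_fubini_tonelli_F (fun z => ((beta i z) ^+ 2)%:E)).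
have F0 t : (0 <= F t)%E by apply: sume_ge0 => i _; apply: integral_ge0.
apply: (@le_lt_trans _ _ (\int[m1]_t (F t * (dotL2 x x)%:E))%E).
  apply: ae_ge0_le_integral => //.
  - by move=> t _; rewrite lee_fin sqr_ge0.
  - by apply/measurable_EFinP/measurable_funX; exact: measurable_pint.
  - by move=> t _; rewrite mule_ge0// lee_fin dotL2_ge0.
  - exact: emeasurable_funM.
  have := ae_section beta; apply: filterS => t [g gP] _.
  rewrite (pint_section x gP) (_ : F t = (dotL2 g g)%:E); last first.
    rewrite dotL2E; apply: eq_bigr => i _; apply: eq_integral => tau _.
    by rewrite gP.
  rewrite -EFinM lee_fin -(normL2_sqr g) -(normL2_sqr x) -exprMn.
  rewrite -real_normK ?num_real// ler_sqr ?nnegrE ?mulr_ge0 ?normL2_ge0//.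
  exact: ler_normL2_dot.
rewrite ge0_integralZr//; last by rewrite lee_fin dotL2_ge0.
rewrite lte_mul_pinfty ?integral_ge0//; last exact: ltry.
rewrite ge0_fin_numE; last by rewrite integral_ge0.
rewrite ge0_integral_sum//; last 2 first.
  move=> i; exact: (measurable_fun_fubini_tonelli_F (fun z => ((beta i z) ^+ 2)%:E)).
  by move=> i t _; apply: integral_ge0.
apply: lte_sum_pinfty => i _.
rewrite -(fubini_tonelli1 (fun z => ((beta i z) ^+ 2)%:E))//.
exact: Lfun2_sqr_lty.
Qed.

Definition pintL2 beta x : L2 m1 1 :=
  [ffun=> mkLfun2 (measurable_pint beta x) (pint_lty beta x)].

Lemma pintL2E beta x i t : pintL2 beta x i t = pint beta x t.
Proof. by rewrite ffunE. Qed.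

(** Fubini. In this form the pairing is linear in [beta], and exchanging the variables leads to the
    adjoint. *)
Lemma dot_pintL2 beta x phi :
  dotL2 (pintL2 beta x) phi = dotL2 beta (tens phi x).
Proof.
rewrite /dotL2 big_ord1 /Rintegral.
rewrite sum_fine; last first.
  by move=> i _; apply: integrable_fin_num => //; exact: L2_integrableM.
congr fine.
rewrite -(@integral_sum _ _ _ m12 setT)//; last first.
  by move=> i; exact: L2_integrableM.
have I2 : m12.-integrable setT
    (fun z => (\sum_(i < p) (beta i z * tens phi x i z)%:E)%E).
  by apply: integrable_sum => // i _; exact: L2_integrableM.
rewrite -integral12_prod_meas1//.
apply: ae_eq_integral => //.
- apply/measurable_EFinP/measurable_funM; exact: measurable_Lfun2.
- exact: (measurable_fubini_F I2).
have := ae_section beta; apply: filterS => t [g gP] _.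
rewrite /fubini_F pintL2E (pint_section x gP) mulrC.
under eq_integral => tau _.
  rewrite sumEFin (_ : \sum_(i < p) _ =
    phi ord0 t * (\sum_(i < p) g i tau * x i tau)); last first.
    rewrite mulr_sumr; apply: eq_bigr => i _.
    by rewrite gP ffunE/= mulrCA.
  over.
rewrite -Rintegral_sumM.
have Ig : m2.-integrable setT (fun tau => (\sum_(i < p) g i tau * x i tau)%:E).
  apply: (@eq_integrable _ _ _ m2 _ measurableT
    (fun tau => (\sum_(i < p) (g i tau * x i tau)%:E)%E)).
    by move=> z _; rewrite sumEFin.
  by apply: integrable_sum => // i _; exact: L2_integrableM.
rewrite -RintegralZl// /Rintegral fineK//.
apply: integrable_fin_num => //.
under eq_fun do rewrite EFinM.
exact: integrableZl.
Qed.

End partial_integral.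

Section partial_adjoint.
Context (R : realType) (d1 d2 : measure_display).
Context (T1 : measurableType d1) (T2 : measurableType d2).
Variable m1 : {finite_measure set T1 -> \bar R}.
Variable m2 : {finite_measure set T2 -> \bar R}.
Local Notation m12 := (m1 \x m2)%E.
Local Notation m21 := (m2 \x m1)%E.
Variable p : nat.
Implicit Types (beta : L2 m12 p) (x y : L2 m2 p) (phi : L2 m1 1).

Let col1 (f : LfunType m21 (@lee1n R 2)) : L2 m21 1 := [ffun=> f].

(** The adjoint of [pintL2 beta], see [dot_pint_padj]. It is made of operators [pintL2] again, whose
    kernels are the coordinates of [beta] with the variables exchanged. *)
Definition padj beta phi : L2 m2 p :=
  [ffun i => pintL2 (col1 (swapL (beta i))) phi ord0].

Lemma bopE beta phi i tau :
  padj beta phi i tau = \int[m1]_t (beta i (t, tau) * phi ord0 t).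
Proof.
rewrite ffunE pintL2E /pint; apply: eq_Rintegral => t _.
by rewrite big_ord1 ffunE.
Qed.

Lemma dot_padj beta phi x : dotL2 (padj beta phi) x = dotL2 beta (tens phi x).
Proof.
rewrite /dotL2; apply: eq_bigr => i _.
have := dot_pintL2 (col1 (swapL (beta i))) phi ([ffun=> x i] : L2 m2 1).
rewrite {1 2}/dotL2 !big_ord1 => h.
transitivity (\int[m2]_t (pintL2 (col1 (swapL (beta i))) phi ord0 t *
    ([ffun=> x i] : L2 m2 1) ord0 t)).
  by apply: eq_Rintegral => t _; rewrite !ffunE.
rewrite h /Rintegral; congr fine.
rewrite -(integral_swap (L2_integrableM beta (tens phi x) i)).
by apply: eq_integral => z _ /=; rewrite !tensE !ffunE/= [x i _ * _]mulrC.
Qed.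

Lemma dot_pint_padj beta x phi :
  dotL2 (pintL2 beta x) phi = dotL2 (padj beta phi) x.
Proof. by rewrite dot_padj dot_pintL2. Qed.

(** The operator with kernel [tens phi x] has rank one: it sends y to <x, y> phi. *)
Lemma dot_tens phi phi' x y :
  dotL2 (tens phi x) (tens phi' y) = dotL2 phi phi' * dotL2 x y.
Proof.
rewrite -dot_pintL2 mulrC -dotL2Zl; congr dotL2.
apply/ffunP => i; apply/LfuneqP => t; rewrite pintL2E L2Z /pint (ord1 i).
rewrite mulrC -Rintegral_sumM -RintegralZl//.
  apply: eq_Rintegral => tau _; rewrite mulr_sumr; apply: eq_bigr => j _.
  by rewrite tensE /= mulrA.
apply: (@eq_integrable _ _ _ m2 _ measurableT
  (fun tau => (\sum_(i < p) (x i tau * y i tau)%:E)%E)).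
  by move=> z _; rewrite sumEFin.
by apply: integrable_sum => // j _; exact: L2_integrableM.
Qed.

Lemma normL2_tens phi x : normL2 (tens phi x) = normL2 phi * normL2 x.
Proof. by rewrite /normL2 dot_tens sqrtrM// dotL2_ge0. Qed.

(** With B = [pintL2 beta], testing against B x gives |B x|^2 <= |beta| |B x| |x|, and one factor |B
    x| cancels. *)
Lemma normL2_pint beta x : normL2 (pintL2 beta x) <= normL2 beta * normL2 x.
Proof.
have := ler_normL2_dot beta (tens (pintL2 beta x) x).
rewrite -dot_pintL2 ger0_norm ?dotL2_ge0// -normL2_sqr normL2_tens.
have := normL2_ge0 (pintL2 beta x).
rewrite le_eqVlt => /predU1P[<- _|n0]; first by rewrite mulr_ge0 ?normL2_ge0.
by rewrite expr2 mulrCA ler_pM2l.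
Qed.

End partial_adjoint.

(** * Kernels expanded along an orthonormal basis *)

Section tensorL2.
Context (R : realType) (d : measure_display) (T : measurableType d).
Variable mu : {finite_measure set T -> \bar R}.
Local Notation mu2 := (mu \x mu)%E.
Variable p : nat.
Implicit Types (beta : L2 mu2 p) (x y : L2 mu p) (phi : L2 mu 1).

Lemma tensorL2E phi x i z : tensorL2 phi x i z = phi ord0 z.1 * x i z.2.
Proof. by rewrite ffunE. Qed.

Lemma tensorL2_tens phi x : tensorL2 phi x = tens phi x.
Proof.
by apply/ffunP => i; apply/LfuneqP => z; rewrite tensorL2E tensE.
Qed.

Lemma dot_padj_tensor beta phi x :
  dotL2 (padj beta phi) x = dotL2 beta (tensorL2 phi x).
Proof. by rewrite dot_padj tensorL2_tens. Qed.

Lemma tensorL2Dr phi x y : tensorL2 phi (x + y) = tensorL2 phi x + tensorL2 phi y.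
Proof.
apply/ffunP => i; apply/LfuneqP => z.
by rewrite (L2D (tensorL2 phi x)) !tensorL2E L2D mulrDr.
Qed.

Lemma tensorL2Zr phi (a : R) x : tensorL2 phi (a *: x) = a *: tensorL2 phi x.
Proof.
apply/ffunP => i; apply/LfuneqP => z.
by rewrite (L2Z a (tensorL2 phi x)) !tensorL2E L2Z mulrCA.
Qed.

Lemma tensorL2Br phi x y : tensorL2 phi (x - y) = tensorL2 phi x - tensorL2 phi y.
Proof. by rewrite -scaleN1r tensorL2Dr tensorL2Zr scaleN1r. Qed.

Lemma tensorL2_sum phi n (Q : pred 'I_n) (F : 'I_n -> L2 mu p) :
  tensorL2 phi (\sum_(i < n | Q i) F i) = \sum_(i < n | Q i) tensorL2 phi (F i).
Proof.
elim/big_rec2 : _ => [|i y x _ <-]; last by rewrite tensorL2Dr.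
by have := tensorL2Br phi 0 0; rewrite !subrr.
Qed.

Lemma dot_tensorL2 phi phi' x y :
  dotL2 (tensorL2 phi x) (tensorL2 phi' y) = dotL2 phi phi' * dotL2 x y.
Proof. by rewrite !tensorL2_tens dot_tens. Qed.

Lemma normL2_tensor phi x : normL2 (tensorL2 phi x) = normL2 phi * normL2 x.
Proof. by rewrite /normL2 dot_tensorL2 sqrtrM// dotL2_ge0. Qed.

Lemma cvg_tensorL2 phi (u : nat -> L2 mu p) x : u @ \oo --> x ->
  tensorL2 phi (u n) @[n --> \oo] --> tensorL2 phi x.
Proof.
move=> /cvgL2P ux; apply/cvgL2P => e e0.
have h : 0 < normL2 phi + 1 by rewrite ltr_wpDl ?normL2_ge0.
have [N NP] := ux _ (divr_gt0 e0 h).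
exists N => n /NP; rewrite ltr_pdivlMr// => hn.
rewrite -tensorL2Br normL2_tensor mulrC (le_lt_trans _ hn)//.
by rewrite ler_wpM2l ?normL2_ge0// lerDl.
Qed.

Lemma dot_padjB beta beta' phi x :
  dotL2 (padj (beta - beta') phi) x = dotL2 (padj beta phi) x - dotL2 (padj beta' phi) x.
Proof. by rewrite !dot_padj dotL2Bl. Qed.

Variable phi : nat -> L2 mu 1.
Hypothesis hphi : orthonormal_basis setT setT phi.

Lemma basis_parseval (g : L2 mu 1) :
  (\sum_(k <oo) (dotL2 g (phi k) ^+ 2)%:E = (dotL2 g g)%:E)%E.
Proof.
case: hphi => _ on _ /(_ g I) cg.
have h := @parseval _ _ _ _ _ setT phi (fun l m _ _ => on l m I I) g cg.
apply/cvg_lim => //; apply: cvg_EFin; first by apply: nearW => n; rewrite sumEFin.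
rewrite (eq_cvg _ _ (g := fun n => \sum_(l < n | (l : nat) \in setT)
  dotL2 g (phi l) ^+ 2))// => n /=.
by rewrite sumEFin/= big_mkord; apply: eq_bigl => i; rewrite in_setT.
Qed.

(** This is the Hilbert-Schmidt norm of the operator with kernel [beta]. Monotone convergence brings
    the sum under the integral over tau, where Parseval applies to t -> beta(t, tau) for almost
    every tau. *)
Lemma padj_parseval beta :
  (\sum_(k <oo) (dotL2 (padj beta (phi k)) (padj beta (phi k)))%:E =
   (dotL2 beta beta)%:E)%E.
Proof.
under eq_eseriesr do rewrite dotL2E.
have m1 i k : measurable_fun setT (fun t => (padj beta (phi k) i t ^+ 2)%:E).
  apply/measurable_EFinP/measurable_funX; exact: measurable_Lfun2.
have p1 i k t : (0 <= (padj beta (phi k) i t ^+ 2)%:E)%E by rewrite lee_fin sqr_ge0.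
rewrite nneseries_sum; last by move=> i k _; apply: integral_ge0.
rewrite dotL2E; apply: eq_bigr => i _.
rewrite -integral_nneseries//.
have mz : measurable_fun setT (fun z => (swapL (beta i) z ^+ 2)%:E).
  apply/measurable_EFinP/measurable_funX; exact: measurable_Lfun2.
have z0 z : (0 <= (swapL (beta i) z ^+ 2)%:E)%E by rewrite lee_fin sqr_ge0.
rewrite -(@ge0_integral_swap _ _ _ _ _ mu mu (fun z => (beta i z ^+ 2)%:E)); last 2 first.
- apply/measurable_EFinP/measurable_funX; exact: measurable_Lfun2.
- by move=> z; rewrite lee_fin sqr_ge0.
rewrite [RHS](fubini_tonelli1 (fun z => (swapL (beta i) z ^+ 2)%:E))//.
apply: ae_eq_integral => //.
- by apply: ge0_emeasurable_sum => // k t _ _; exact: p1.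
- exact: (measurable_fun_fubini_tonelli_F (fun z => (swapL (beta i) z ^+ 2)%:E)).
have := ae_section ([ffun=> swapL (beta i)] : L2 mu2 1); apply: filterS => tau [g gP] _.
rewrite /fubini_F.
transitivity (dotL2 g g)%:E.
  rewrite -basis_parseval; apply: eq_eseriesr => k _.
  by rewrite ffunE pintL2E (pint_section _ gP).
rewrite dotL2E big_ord1; apply: eq_integral => t _.
by rewrite gP ffunE.
Qed.

(** The squared error of the n-th partial sum is |beta|^2 minus the n-th partial sum in
    [padj_parseval]. *)
Lemma tensor_expansion beta :
  (\sum_(k < n) tensorL2 (phi k) (padj beta (phi k))) @[n --> \oo] --> beta.
Proof.
case: (hphi) => _ on _ _.
pose b k := dotL2 (padj beta (phi k)) (padj beta (phi k)).
have cb : (\sum_(k < n) b k) @[n --> \oo] --> dotL2 beta beta.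
  have := padj_parseval beta => h.
  have : (fun n => (\sum_(0 <= k < n) (b k)%:E)%E) @ \oo --> (dotL2 beta beta)%:E.
    rewrite -h; apply: is_cvg_nneseries => k _ _.
    by rewrite lee_fin dotL2_ge0.
  move=> /fine_cvgP[_]; rewrite (eq_cvg _ _ (g := fun n => \sum_(k < n) b k))//.
  by move=> n /=; rewrite sumEFin/= big_mkord.
have E n : normL2 (\sum_(k < n) tensorL2 (phi k) (padj beta (phi k)) - beta) ^+ 2 =
    dotL2 beta beta - \sum_(k < n) b k.
  rewrite normL2B_sqr !normL2_sqr.
  have -> : dotL2 (\sum_(k < n) tensorL2 (phi k) (padj beta (phi k))) beta =
      \sum_(k < n) b k.
    by rewrite dotL2_suml; apply: eq_bigr => k _; rewrite dotL2C -dot_padj_tensor.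
  have -> : dotL2 (\sum_(k < n) tensorL2 (phi k) (padj beta (phi k)))
     (\sum_(k < n) tensorL2 (phi k) (padj beta (phi k))) = \sum_(k < n) b k.
    rewrite -(big_mkord xpredT (fun k => tensorL2 (phi k) (padj beta (phi k)))).
    rewrite sqr_orthogonal_sum ?iota_uniq//; last first.
      by move=> i j ij; rewrite dot_tensorL2 on// (negbTE ij) mul0r.
    by rewrite big_mkord; apply: eq_bigr => k _; rewrite dot_tensorL2 on// eqxx mul1r.
  ring.
apply/cvgL2P => e e0.
have e2 : 0 < e ^+ 2 by rewrite exprn_gt0.
move/cvgrPdist_lt : cb => /(_ _ e2)[N _ NP].
exists N => n Nn; have := NP _ Nn; rewrite /= => h.
rewrite -ltr_sqr ?nnegrE ?normL2_ge0 ?(ltW e0)// E.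
by rewrite (le_lt_trans (ler_norm _)).
Qed.

Lemma padj_eq0 beta : (forall k, eqL2 (padj beta (phi k)) 0) -> eqL2 beta 0.
Proof.
move=> H; apply/eqL2_normP; rewrite subr0 /normL2.
suff -> : dotL2 beta beta = 0 by rewrite sqrtr0.
apply: EFin_inj; rewrite -padj_parseval eseries0// => k _ _.
by rewrite (eqL2_dotl _ (H k)) dotL20l.
Qed.

End tensorL2.

(** * Random elements and their scores *)

Section borel_dot.
Context (R : realType) (d : measure_display) (T : measurableType d).
Variables (mu : {measure set T -> \bar R}) (k : nat).

Lemma open_dotL2_gt (g : L2 mu k) (a : R) : open [set f : L2 mu k | a < dotL2 f g].
Proof.
rewrite openE => f /= af.
have g1 : 0 < normL2 g + 1 by rewrite ltr_wpDl ?normL2_ge0.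
have e0 : 0 < dotL2 f g - a by rewrite subr_gt0.
apply/nbhs_ballP; exists ((dotL2 f g - a) / (normL2 g + 1)) => /=.
  by rewrite divr_gt0.
move=> h fh; change (is_true (normL2 (f - h) < (dotL2 f g - a) / (normL2 g + 1))) in fh.
rewrite ltr_pdivlMr// in fh.
have : dotL2 (f - h) g <= normL2 (f - h) * (normL2 g + 1).
  rewrite (le_trans (dotL2_le_norm _ _))// ler_wpM2l ?normL2_ge0 ?lerDl//.
by rewrite dotL2Bl /=; move: (dotL2 f g) (dotL2 h g) fh => x y; lra.
Qed.

(** Good sets argument: the sets with Borel preimage form a sigma-algebra that contains the
    half-lines above each [a], whose preimages are open. *)
Lemma borelL2_dot (g : L2 mu k) (B : set R) : measurable B ->
  borelL2 [set f : L2 mu k | B (dotL2 f g)].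
Proof.
pose C := [set B : set R | borelL2 [set f : L2 mu k | B (dotL2 f g)]].
have [b0 bD bU] := smallest_sigma_algebra setT [set B : set (L2 mu k) | open B].
have sC : sigma_algebra setT C.
  split.
  - change (borelL2 [set f : L2 mu k | set0 (dotL2 f g)]).
    by rewrite (_ : [set f | _] = set0)//; apply/seteqP; split.
  - move=> A /bD; rewrite !setTD => h; exact: h.
  - by move=> F /bU h; exact: h.
move=> mB; have {}mB : (@RGenOInfty.G R).-sigma.-measurable B
  by rewrite -RGenOInfty.measurableE.
move: B mB; apply: (smallest_sub sC) => _ [a ->].
apply: sub_sigma_algebra; rewrite /= (_ : [set _ | _] = [set f | a < dotL2 f g]).
  exact: open_dotL2_gt.
by apply/seteqP; split => f /=; rewrite in_itv/= andbT.
Qed.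

Lemma measurable_borel_dot (d' : measure_display) (Omega : measurableType d')
    (U : Omega -> L2 mu k) (g : L2 mu k) :
  (forall B, borelL2 B -> measurable (U @^-1` B)) ->
  measurable_fun setT (fun w => dotL2 (U w) g).
Proof.
move=> mU _ B mB; rewrite setTI.
exact: (mU _ (borelL2_dot g mB)).
Qed.

End borel_dot.

Section independence.
Context (R : realType) (d : measure_display) (Omega : measurableType d).
Variable Q : probability Omega R.

(** On rectangles the joint law agrees with the product of the marginal laws, hence everywhere by
    uniqueness of the product measure; Fubini then factors the integral. *)
Lemma integral_indep_mul (X Y : Omega -> R) :
  measurable_fun setT X -> measurable_fun setT Y ->
  Q.-integrable setT (EFin \o X) -> Q.-integrable setT (EFin \o Y) ->
  Q.-integrable setT (EFin \o (fun w => X w * Y w)) ->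
  (forall B C, measurable B -> measurable C ->
    (Q (X @^-1` B `&` Y @^-1` C) = Q (X @^-1` B) * Q (Y @^-1` C))%E) ->
  (\int[Q]_w (X w * Y w)%:E = (\int[Q]_w (X w)%:E) * (\int[Q]_w (Y w)%:E))%E.
Proof.
move=> mX mY iX iY iXY ind.
pose Xm : {mfun Omega >-> R} := mfun_Sub (mem_set mX).
pose Ym : {mfun Omega >-> R} := mfun_Sub (mem_set mY).
pose PX := distribution Q Xm.
pose PY := distribution Q Ym.
have mXY : measurable_fun setT (fun w => (X w, Y w)).
  exact/measurable_fun_pair.
pose XY : {mfun Omega >-> (R * R)%type} :=
  mfun_Sub (mem_set mXY).
pose PXY := distribution Q XY.
have PE (Z : set _) : measurable Z -> (PX \x PY)%E Z = PXY Z.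
  apply: product_measure_unique => B C mB mC.
  exact: ind.
have mM : measurable_fun setT (fun z : R * R => (z.1 * z.2)%:E).
  by apply/measurable_EFinP/measurable_funM.
transitivity (\int[PXY]_z (z.1 * z.2)%:E)%E.
  by rewrite integral_distribution.
have iPXY : PXY.-integrable setT (fun z => (z.1 * z.2)%:E).
  exact: integrable_pushforward.
have eqI f : (\int[PXY]_z f z = \int[(PX \x PY)%E]_z f z)%E.
  by apply: eq_measure_integral => Z mZ _; apply/esym; exact: PE.
have iP : (PX \x PY)%E.-integrable setT (fun z => (z.1 * z.2)%:E).
  apply/integrableP; split => //; rewrite -eqI.
  by case/integrableP : iPXY.
have iX' : PX.-integrable setT EFin by apply: integrable_pushforward.
have iY' : PY.-integrable setT EFin by apply: integrable_pushforward.
rewrite eqI -integral12_prod_meas1// /fubini_F.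
transitivity (\int[PX]_x (x%:E * \int[PY]_y y%:E))%E.
  apply: eq_integral => x _ /=.
  by under eq_integral do rewrite EFinM; rewrite integralZl.
rewrite -(fineK (integrable_fin_num measurableT iY')) integralZr//.
rewrite fineK; last exact: integrable_fin_num.
by rewrite !integral_distribution.
Qed.

End independence.

Section random_variable.
Context (R : realType) (dO : measure_display) (Omega : measurableType dO).
Variable P : probability Omega R.
Context (d : measure_display) (T : measurableType d).
Variables (mu : {finite_measure set T -> \bar R}) (k : nat).
Local Notation mu2 := (mu \x mu)%E.
Variable U : Omega -> L2 mu k.
Hypothesis jU : forall i, measurable_fun setT (fun z : Omega * T => U z.1 i z.2).
Hypothesis fU : (sqnormV P U < +oo)%E.

Let mU2 i : measurable_fun setT (fun z : Omega * T => ((U z.1 i z.2) ^+ 2)%:E).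
Proof. by apply/measurable_EFinP/measurable_funX. Qed.

Let sqnormV_joint :
  (sqnormV P U = \sum_(i < k) \int[(P \x mu)%E]_z ((U z.1 i z.2) ^+ 2)%:E)%E.
Proof.
apply: eq_bigr => i _.
rewrite (fubini_tonelli2 (fun z => ((U z.1 i z.2) ^+ 2)%:E))//; last first.
  by move=> z; rewrite lee_fin sqr_ge0.
by apply: eq_integral => t _; rewrite unlock.
Qed.

Lemma joint_lty i : (\int[(P \x mu)%E]_z ((U z.1 i z.2) ^+ 2)%:E < +oo)%E.
Proof.
apply: le_lt_trans fU; rewrite sqnormV_joint (bigD1 i)//= leeDl//.
by apply: sume_ge0 => j _; apply: integral_ge0 => z _; rewrite lee_fin sqr_ge0.
Qed.

Definition joint : L2 (P \x mu)%E k :=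
  [ffun i => mkLfun2 (jU i) (joint_lty i)].

Lemma jointE i z : joint i z = U z.1 i z.2.
Proof. by rewrite ffunE. Qed.

Lemma dot_joint : ((dotL2 joint joint)%:E = sqnormV P U)%E.
Proof.
rewrite sqnormV_joint dotL2E; apply: eq_bigr => i _.
by apply: eq_integral => z _; rewrite jointE.
Qed.

(* Second-moment random variables are kept as elements of L2 P 1, so that
   dotL2 of two scores is the expectation of their product. *)
Definition score (g : L2 mu k) : L2 P 1 := pintL2 joint g.

Lemma scoreE g i w : score g i w = dotL2 (U w) g.
Proof.
by rewrite pintL2E (pint_section g (g := U w))// => j t; rewrite jointE.
Qed.

Lemma scoreD g h : score (g + h) = score g + score h.
Proof.
by apply/ffunP => i; apply/LfuneqP => w; rewrite L2D !scoreE dotL2Dr.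
Qed.

Lemma scoreZ a g : score (a *: g) = a *: score g.
Proof.
by apply/ffunP => i; apply/LfuneqP => w; rewrite L2Z !scoreE dotL2Zr.
Qed.

Lemma moment_kernelE s t i j :
  moment_kernel P U s t i j = \int[P]_w (joint i (w, s) * joint j (w, t)).
Proof.
rewrite mxE /Rintegral unlock; congr fine; apply: eq_integral => w _.
by rewrite !jointE.
Qed.

(** The covariance operator factors as the adjoint of [score] after [score]. For almost every t the
    variable w -> U_t(w)(j) lies in L^2(P), which makes s -> K(s, t) itself an image under
    [padj]. *)
Lemma ae_kernel_row (f : L2 mu k) j :
  {ae mu, forall t, \int[mu]_s (\row_i f i s *m moment_kernel P U s t) 0 j =
                    padj joint (score f) j t}.
Proof.
have := ae_section ([ffun=> swapL (joint j)] : L2 (mu \x P)%E 1).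
apply: filterS => t [g gP].
have gE w : g ord0 w = joint j (w, t) by rewrite gP ffunE.
have ME i s : moment_kernel P U s t i j = padj joint g i s.
  rewrite moment_kernelE bopE; apply: eq_Rintegral => w _.
  by rewrite gE.
transitivity (dotL2 f (padj joint g)).
  rewrite -Rintegral_sumM; apply: eq_Rintegral => s _.
  by rewrite mxE; apply: eq_bigr => i _; rewrite ME mxE.
rewrite dotL2C -dot_pint_padj bopE /dotL2 big_ord1; apply: eq_Rintegral => w _.
by rewrite gE mulrC.
Qed.

End random_variable.

Section tens_sqr.
Context (R : realType) (d1 d2 : measure_display).
Context (T1 : measurableType d1) (T2 : measurableType d2).
Variable m1 : {finite_measure set T1 -> \bar R}.
Variable m2 : {finite_measure set T2 -> \bar R}.

Lemma integral_tens_sqr (f : LfunType m1 (@lee1n R 2)) (g : LfunType m2 (@lee1n R 2)) :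
  (\int[m1 \x m2]_z ((f z.1 * g z.2) ^+ 2)%:E =
   \int[m1]_t (f t ^+ 2)%:E * \int[m2]_t (g t ^+ 2)%:E)%E.
Proof.
pose f1 : L2 m1 1 := [ffun=> f]; pose g1 : L2 m2 1 := [ffun=> g].
have := congr1 EFin (dot_tens f1 f1 g1 g1).
rewrite EFinM !dotL2E !big_ord1.
by rewrite !ffunE.
Qed.

End tens_sqr.

Section square_measure.
Context (R : realType) (d : measure_display) (T : measurableType d).
Variable mu : {finite_measure set T -> \bar R}.

(* The library declares the product of two measures finite only for
   subprobabilities; this alias carries the structure needed by Fubini on a
   triple product. *)
Definition square_measure : set (T * T) -> \bar R := (mu \x mu)%E.

HB.instance Definition _ := Measure.on square_measure.

Let square_measure_fin : fin_num_fun square_measure.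
Proof.
move=> X mX; rewrite ge0_fin_numE//.
have : (square_measure setT < +oo)%E.
  rewrite /square_measure -setXTT product_measure1E//.
  by rewrite lte_mul_pinfty// ?fin_num_measure// -ge0_fin_numE// fin_num_measure.
by apply: le_lt_trans; rewrite le_measure ?inE.
Qed.

HB.instance Definition _ := @Measure_isFinite.Build _ _ _ square_measure
  square_measure_fin.

End square_measure.

(** * The quadratic form of a moment kernel *)

Section kernel_form.
Context (R : realType) (dO : measure_display) (Omega : measurableType dO).
Variable P : probability Omega R.
Context (d : measure_display) (T : measurableType d).
Variables (mu : {finite_measure set T -> \bar R}) (k : nat).
Local Notation mu2 := (square_measure mu).
Variable U : Omega -> L2 mu k.
Hypothesis jU : forall i, measurable_fun setT (fun z : Omega * T => U z.1 i z.2).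
Hypothesis fU : (sqnormV P U < +oo)%E.
Local Notation LT := (LfunType mu (@lee1n R 2)).

Let meas1 i : measurable_fun setT (fun z : Omega * (T * T) => U z.1 i z.2.1).
Proof.
have h : measurable_fun setT (fun z : Omega * (T * T) => (z.1, z.2.1)).
  by apply/measurable_fun_pair => //=; exact: measurableT_comp.
exact: (measurableT_comp (jU i) h).
Qed.

Let meas2 i : measurable_fun setT (fun z : Omega * (T * T) => U z.1 i z.2.2).
Proof.
have h : measurable_fun setT (fun z : Omega * (T * T) => (z.1, z.2.2)).
  by apply/measurable_fun_pair => //=; exact: measurableT_comp.
exact: (measurableT_comp (jU i) h).
Qed.

Let in2_lty i (g : LT) :
  (\int[P]_w (\int[mu]_s ((U w i s) ^+ 2)%:E * \int[mu]_t (g t ^+ 2)%:E) < +oo)%E.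
Proof.
have m2 : measurable_fun setT (fun z : Omega * T => ((U z.1 i z.2) ^+ 2)%:E).
  by apply/measurable_EFinP/measurable_funX.
have z0 (z : Omega * T) : (0 <= ((U z.1 i z.2) ^+ 2)%:E)%E by rewrite lee_fin sqr_ge0.
rewrite ge0_integralZr//.
- rewrite lte_mul_pinfty ?Lfun2_sqr_lty//.
  + by apply: integral_ge0 => w _; apply: integral_ge0 => t _; rewrite lee_fin sqr_ge0.
  + rewrite ge0_fin_numE.
      by rewrite -(fubini_tonelli1 (fun z => ((U z.1 i z.2) ^+ 2)%:E))// (joint_lty jU fU).
    by apply: integral_ge0 => w _; apply: integral_ge0 => t _; rewrite lee_fin sqr_ge0.
- exact: (measurable_fun_fubini_tonelli_F (fun z => ((U z.1 i z.2) ^+ 2)%:E)).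
- by move=> w _; apply: integral_ge0 => t _; rewrite lee_fin sqr_ge0.
- by apply: integral_ge0 => t _; rewrite lee_fin sqr_ge0.
Qed.

(** The integrand g_i(s) g_j(t) U_s(i) U_t(j) is grouped as (U_s(i) g_j(t)) (U_t(j) g_i(s)): by this
    and [Lfun2_] both factors are square-integrable on the triple product, so the integrand is
    integrable. *)
Let Lfun1_ i (g : LT) :
  (fun z : Omega * (T * T) => U z.1 i z.2.1 * g z.2.2) \in
    Lfun (P \x mu2)%E 2%:E.
Proof.
have m1 : measurable_fun setT (fun z : Omega * (T * T) => U z.1 i z.2.1 * g z.2.2).
  apply: measurable_funM => //.
  by apply: (measurableT_comp (measurable_Lfun2 g)); exact: measurableT_comp.
apply: Lfun2P => //.
rewrite (fubini_tonelli1 (fun z => ((U z.1 i z.2.1 * g z.2.2) ^+ 2)%:E)); last 2 first.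
- by apply/measurable_EFinP/measurable_funX.
- by move=> z; rewrite lee_fin sqr_ge0.
apply: le_lt_trans (in2_lty i g); rewrite le_eqVlt; apply/orP; left; apply/eqP.
by apply: eq_integral => w _; rewrite /fubini_F/= integral_tens_sqr.
Qed.

Let Lfun2_ i (g : LT) :
  (fun z : Omega * (T * T) => U z.1 i z.2.2 * g z.2.1) \in
    Lfun (P \x mu2)%E 2%:E.
Proof.
have m1 : measurable_fun setT (fun z : Omega * (T * T) => U z.1 i z.2.2 * g z.2.1).
  apply: measurable_funM => //.
  by apply: (measurableT_comp (measurable_Lfun2 g)); exact: measurableT_comp.
apply: Lfun2P => //.
rewrite (fubini_tonelli1 (fun z => ((U z.1 i z.2.2 * g z.2.1) ^+ 2)%:E)); last 2 first.
- by apply/measurable_EFinP/measurable_funX.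
- by move=> z; rewrite lee_fin sqr_ge0.
apply: le_lt_trans (in2_lty i g); rewrite le_eqVlt; apply/orP; left; apply/eqP.
apply: eq_integral => w _; rewrite /fubini_F/= muleC -integral_tens_sqr.
by apply: eq_integral => z _; rewrite mulrC.
Qed.

Let one_ : LT := Lfun_Sub (@lee1n R 2) (Lfun_cst mu 1 2).

Lemma kernel_integrable (g : L2 mu k) i j :
  mu2.-integrable setT
    (fun z => (g i z.1 * moment_kernel P U z.1 z.2 i j * g j z.2)%:E).
Proof.
have IUU : (P \x mu2)%E.-integrable setT
    (fun z => (U z.1 i z.2.1 * U z.1 j z.2.2)%:E).
  have /Lfun1_integrable := Lfun2_mul_Lfun1 (Lfun1_ i one_) (Lfun2_ j one_).
  by apply: eq_integrable => // z _ /=; rewrite !mulr1.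
have IH : (P \x mu2)%E.-integrable setT
    (fun z => (g i z.2.1 * g j z.2.2 * (U z.1 i z.2.1 * U z.1 j z.2.2))%:E).
  have /Lfun1_integrable := Lfun2_mul_Lfun1 (Lfun1_ i (g j)) (Lfun2_ j (g i)).
  by apply: eq_integrable => // z _ /=; congr EFin; ring.
have mM : measurable_fun setT (fun z => moment_kernel P U z.1 z.2 i j).
  have := measurable_fubini_G IUU => mG.
  rewrite (_ : (fun z => _) = fine \o fubini_G P
     (fun z => (U z.1 i z.2.1 * U z.1 j z.2.2)%:E)).
    by apply: measurableT_comp => //; exact: fine_measurable.
  by apply/funext => z; rewrite mxE unlock.
have mgMg : measurable_fun setT
    (fun z => (g i z.1 * moment_kernel P U z.1 z.2 i j * g j z.2)%:E).
  apply/measurable_EFinP; apply: measurable_funM; last first.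
    by apply: measurableT_comp => //; exact: measurable_Lfun2.
  apply: measurable_funM => //.
  by apply: measurableT_comp => //; exact: measurable_Lfun2.
(* Integrating w out of [IH] leaves the kernel term wherever the expectation of U_s(i) U_t(j) is
   finite, so Fubini gives its integrability. *)
have /integrableP[mG] := integrable_fubini_F (integrable_swap IH).
move=> Gy; apply/integrableP; split => //; apply: le_lt_trans Gy.
rewrite le_eqVlt; apply/orP; left; apply/eqP.
apply: ae_eq_integral => //.
- exact: measurableT_comp.
- exact: measurableT_comp.
have := ae_integrable2 IUU; apply: filterS => z Iz _ /=.
rewrite (_ : fubini_F _ _ z =
  (g i z.1 * moment_kernel P U z.1 z.2 i j * g j z.2)%:E)//.
rewrite /fubini_F/= mxE unlock.
under eq_integral do rewrite EFinM.
rewrite integralZl// -(fineK (integrable_fin_num measurableT Iz)) -EFinM.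
by congr EFin; rewrite mulrAC.
Qed.

(** By [ae_kernel_row], integrating over s first leaves the inner product of [g] with the adjoint of
    [score] applied to [score g]. *)
Lemma kernel_formE (g : L2 mu k) :
  kernel_form P U g = dotL2 (score jU fU g) (score jU fU g).
Proof.
rewrite /kernel_form.
have E z : (\row_i g i z.1 *m moment_kernel P U z.1 z.2 *m (\row_i g i z.2)^T) 0 0 =
    \sum_(j < k) \sum_(i < k) g i z.1 * moment_kernel P U z.1 z.2 i j * g j z.2.
  rewrite mxE; apply: eq_bigr => j _; rewrite !mxE mulr_suml; apply: eq_bigr => i _.
  by rewrite mxE.
have I : mu2.-integrable setT (fun z => ((\row_i g i z.1 *m
    moment_kernel P U z.1 z.2 *m (\row_i g i z.2)^T) 0 0)%:E).
  apply: (@eq_integrable _ _ _ mu2 _ measurableT (fun z => \sum_(j < k) \sum_(i < k)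
     (g i z.1 * moment_kernel P U z.1 z.2 i j * g j z.2)%:E)%E).
    move=> z _; rewrite E -sumEFin; apply: eq_bigr => j _.
    by rewrite -sumEFin.
  apply: integrable_sum => // j _; apply: integrable_sum => // i _.
  exact: kernel_integrable.
rewrite /Rintegral -(integral21_prod_meas1 I).
rewrite /score dot_pint_padj -Rintegral_sumM /Rintegral; congr fine.
apply: ae_eq_integral => //.
- exact: (measurable_fubini_G I).
- apply/measurable_EFinP; apply: measurable_sum => j.
  by apply: measurable_funM; exact: measurable_Lfun2.
have hr : {ae mu, forall t, forall j, \int[mu]_s (\row_i g i s *m moment_kernel P U s t) 0 j =
                    padj (joint jU fU) (score jU fU g) j t}.
  by apply: filter_forall => j; exact: ae_kernel_row.
have hI : {ae mu, forall t, forall j i, mu.-integrable setT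
    (fun s => (g i s * moment_kernel P U s t i j * g j t)%:E)}.
  apply: filter_forall => j; apply: filter_forall => i.
  exact: ae_integrable2 (kernel_integrable g i j).
move: hr hI; apply: filterS2 => t hr hI _.
rewrite /fubini_G.
under eq_integral => s _ do rewrite (E (s, t)) -sumEFin.
rewrite integral_sum//; last first.
  move=> j; apply: (@eq_integrable _ _ _ mu _ measurableT (fun s => \sum_(i < k)
     (g i s * moment_kernel P U s t i j * g j t)%:E)%E).
    by move=> s _; rewrite sumEFin.
  by apply: integrable_sum => // i _; exact: hI.
rewrite -sumEFin; apply: eq_bigr => j _; rewrite -hr.
(* Integrability without the factor g_j(t) comes from division by it; where it vanishes both sides
   are 0. *)
have [gj0|gj0] := eqVneq (g j t) 0.
  rewrite gj0 mulr0; apply: integral0_eq => s _.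
  by rewrite big1// => i _; rewrite /= mulr0.
have hI' i : mu.-integrable setT (fun s => (g i s * moment_kernel P U s t i j)%:E).
  have := integrableZl measurableT (g j t)^-1 (hI j i).
  by apply: eq_integrable => // s _ /=; rewrite -EFinM; congr EFin; field.
have hS : mu.-integrable setT
    (fun s => ((\row_i g i s *m moment_kernel P U s t) 0 j)%:E).
  apply: (@eq_integrable _ _ _ mu _ measurableT (fun s => \sum_(i < k)
     (g i s * moment_kernel P U s t i j)%:E)%E).
    by move=> s _; rewrite sumEFin mxE; congr EFin; apply: eq_bigr => i _; rewrite [X in _ = X * _]mxE.
  by apply: integrable_sum => // i _; exact: hI'.
rewrite EFinM /Rintegral fineK; last exact: integrable_fin_num.
rewrite -integralZr//; apply: eq_integral => s _ /=.
rewrite -EFinM mxE mulr_suml; congr EFin.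
by apply: eq_bigr => i _; rewrite [X in _ = X * _ * _]mxE.
Qed.

End kernel_form.

Section same_law.
Context (R : realType) (d1 d2 : measure_display).
Context (O1 : measurableType d1) (O2 : measurableType d2).
Variables (Q1 : probability O1 R) (Q2 : probability O2 R).
Variables (X1 : O1 -> R) (X2 : O2 -> R).
Hypotheses (mX1 : measurable_fun setT X1) (mX2 : measurable_fun setT X2).
Hypothesis law : forall B, measurable B -> Q1 (X1 @^-1` B) = Q2 (X2 @^-1` B).

Lemma ge0_integral_same_law (f : R -> \bar R) : measurable_fun setT f ->
  (forall x, 0 <= f x)%E ->
  (\int[Q1]_w f (X1 w) = \int[Q2]_w f (X2 w))%E.
Proof.
move=> mf f0.
have := @ge0_integral_pushforward _ _ _ _ _ X1 mX1 Q1 setT f measurableT mf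
  (fun x _ => f0 x).
rewrite preimage_setT => /= <-.
have := @ge0_integral_pushforward _ _ _ _ _ X2 mX2 Q2 setT f measurableT mf
  (fun x _ => f0 x).
rewrite preimage_setT => /= <-.
by apply: eq_measure_integral => B mB _; exact: law.
Qed.

Lemma integral_same_law : Q2.-integrable setT (EFin \o X2) ->
  (\int[Q1]_w (X1 w)%:E = \int[Q2]_w (X2 w)%:E)%E.
Proof.
move=> iX2.
have iX1 : Q1.-integrable setT (EFin \o X1).
  apply/integrableP; split; first exact/measurable_EFinP.
  rewrite (ge0_integral_same_law (f := fun x => (`|x|)%:E)).
  - by case/integrableP : iX2.
  - by apply/measurable_EFinP.
  - by move=> x; rewrite lee_fin.
have := @integral_pushforward _ _ _ _ _ X1 mX1 Q1 setT EFin _ _ measurableT.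
rewrite preimage_setT => /(_ _ iX1) /= <-//.
have := @integral_pushforward _ _ _ _ _ X2 mX2 Q2 setT EFin _ _ measurableT.
rewrite preimage_setT => /(_ _ iX2) /= <-//.
by apply: eq_measure_integral => B mB _; exact: law.
Qed.

End same_law.

(** * Bochner expectation of the scores *)

Section bochner.
Context (R : realType) (dO : measure_display) (Omega : measurableType dO).
Variable P : probability Omega R.
Context (d : measure_display) (T : measurableType d).
Variables (mu : {finite_measure set T -> \bar R}) (k : nat).

(** Tonelli gives this from joint measurability, a property that passes easily to [U] minus a simple
    function. *)
Lemma measurable_normL2_joint (W : Omega -> L2 mu k) :
  (forall i, measurable_fun setT (fun z : Omega * T => W z.1 i z.2)) ->
  measurable_fun setT (fun w => normL2 (W w)).
Proof.
move=> jW.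
have m2 i : measurable_fun setT (fun z : Omega * T => ((W z.1 i z.2) ^+ 2)%:E).
  by apply/measurable_EFinP/measurable_funX.
have : measurable_fun setT (fun w => (dotL2 (W w) (W w))%:E).
  rewrite (_ : (fun w => _) =
    (fun w => \sum_(i < k) \int[mu]_t ((W w i t) ^+ 2)%:E)%E); last first.
    by apply/funext => w; rewrite dotL2E.
  apply: emeasurable_sum => i.
  apply: (measurable_fun_fubini_tonelli_F
    (fun z : Omega * T => ((W z.1 i z.2) ^+ 2)%:E)) => //.
  by move=> z; rewrite lee_fin sqr_ge0.
by move=> /measurable_EFinP; apply: measurableT_comp; apply: continuous_measurable_fun; exact: sqrt_continuous.
Qed.

Variable U : Omega -> L2 mu k.
Hypothesis jU : forall i, measurable_fun setT (fun z : Omega * T => U z.1 i z.2).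
Hypothesis fU : (sqnormV P U < +oo)%E.

Lemma integrable_score g : P.-integrable setT (fun w => (dotL2 (U w) g)%:E).
Proof.
have : (score jU fU g ord0 : Omega -> R) \in Lfun P 2%:E by exact: LfunP.
have fP : P setT \is a fin_num by exact: fin_num_measure.
move=> /(Lfun_subset12 fP) /Lfun1_integrable.
by apply: eq_integrable => // w _ /=; rewrite scoreE.
Qed.

(** Pairing with [g] commutes with expectation for the simple functions V_n, and |E<U - V_n, g>| <=
    |g| E|U - V_n| carries this to the limit. *)
Lemma bochner_score m g : bochner_expectation P U m ->
  \int[P]_w dotL2 (U w) g = dotL2 m g.
Proof.
case=> s [ms s0 sm].
pose V n w : L2 mu k := \sum_(x <- s n) \1_(x.1) w *: x.2.
pose e n := (\int[P]_w (normL2 (U w - V n w))%:E)%E.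
have VE n w : dotL2 (V n w) g = \sum_(x <- s n) \1_(x.1) w * dotL2 x.2 g.
  by rewrite dotL2_suml; apply: eq_bigr => x _; rewrite dotL2Zl.
have simple (l : seq (set Omega * L2 mu k)) : (forall x, x \in l -> measurable x.1) ->
    P.-integrable setT (EFin \o (fun w => \sum_(x <- l) \1_(x.1) w * dotL2 x.2 g)) /\
    \int[P]_w (\sum_(x <- l) \1_(x.1) w * dotL2 x.2 g) =
    \sum_(x <- l) fine (P x.1) * dotL2 x.2 g.
  elim: l => [_|x l ih ml].
    split; last by rewrite big_nil /Rintegral integral0_eq// => w _; rewrite big_nil.
    apply: (@eq_integrable _ _ _ P _ measurableT (cst 0%E)); last exact: integrable0.
    by move=> w _ /=; rewrite big_nil.
  have mx : measurable x.1 by apply: ml; rewrite mem_head.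
  have [il El] : _ /\ _ := ih (fun y yl => ml y (mem_behead (s := x :: l) yl)).
  have ix : P.-integrable setT (EFin \o (fun w => \1_(x.1) w * dotL2 x.2 g)).
    have := integrableZr measurableT (dotL2 x.2 g) (integrable_indic P mx).
    by apply: eq_integrable => // w _ /=; rewrite EFinM.
  split.
    have := integrableD measurableT ix il.
    by apply: eq_integrable => // w _ /=; rewrite big_cons EFinD.
  rewrite big_cons -El; under eq_Rintegral do rewrite big_cons.
  rewrite RintegralD//; congr (_ + _).
  rewrite RintegralZr//; last exact: integrable_indic.
  by rewrite /Rintegral integral_indic// setIT.
have iV n : P.-integrable setT (fun w => (dotL2 (V n w) g)%:E).
  have [h _] := simple (s n) (ms n).
  by apply: eq_integrable h => // w _ /=; rewrite VE.
have IV n : \int[P]_w dotL2 (V n w) g =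
    dotL2 (\sum_(x <- s n) fine (P x.1) *: x.2) g.
  have [_ h] := simple (s n) (ms n).
  under eq_Rintegral do rewrite VE.
  by rewrite h dotL2_suml; apply: eq_bigr => x _; rewrite dotL2Zl.
have jW n i : measurable_fun setT (fun z : Omega * T => (U z.1 - V n z.1) i z.2).
  have sE (l : seq (set Omega * L2 mu k)) (z : Omega * T) :
      (\sum_(x <- l) \1_(x.1) z.1 *: x.2) i z.2 =
      \sum_(x <- l) \1_(x.1) z.1 * x.2 i z.2.
    elim: l => [|x l ih]; first by rewrite !big_nil ffunE.
    by rewrite !big_cons L2D L2Z ih.
  have mS (l : seq (set Omega * L2 mu k)) : (forall x, x \in l -> measurable x.1) ->
      measurable_fun setT (fun z : Omega * T => \sum_(x <- l) \1_(x.1) z.1 * x.2 i z.2).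
    elim: l => [_|x l ih ml].
      by rewrite (_ : (fun z => _) = cst 0)//; apply/funext => z; rewrite big_nil.
    rewrite (_ : (fun z => _) = (fun z => \1_(x.1) z.1 * x.2 i z.2) \+
      (fun z => \sum_(x <- l) \1_(x.1) z.1 * x.2 i z.2)); last first.
      by apply/funext => z; rewrite big_cons.
    apply: measurable_funD; last first.
      by apply: ih => y yl; apply: ml; rewrite inE yl orbT.
    apply: measurable_funM.
      have h : measurable_fun setT (\1_(x.1) : Omega -> R).
        by apply: measurable_indic; apply: ml; rewrite mem_head.
      by apply: (measurableT_comp h); exact: measurable_fst.
    by apply: measurableT_comp => //; exact: measurable_Lfun2.
  rewrite (_ : (fun z => _) = (fun z => U z.1 i z.2 -
      \sum_(x <- s n) \1_(x.1) z.1 * x.2 i z.2)).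
    by apply: measurable_funB => //; apply: mS; exact: ms.
  by apply/funext => z; rewrite L2D L2N sE.
have mn n : measurable_fun setT (fun w => (normL2 (U w - V n w))%:E).
  by apply/measurable_EFinP; exact: measurable_normL2_joint.
have bnd n : (`|\int[P]_w dotL2 (U w) g -
    dotL2 (\sum_(x <- s n) fine (P x.1) *: x.2) g|%:E <=
    (normL2 g)%:E * e n)%E.
  have iW : P.-integrable setT (EFin \o (fun w => dotL2 (U w) g - dotL2 (V n w) g)).
    have := integrableB measurableT (integrable_score g) (iV n).
    by apply: eq_integrable => // w _ /=.
  rewrite -IV -RintegralB//; [|exact: integrable_score|exact: iV].
  rewrite EFin_normr_Rintegral//.
  apply: (le_trans (le_abse_integral _ _ _)) => //.
    by case/integrableP : iW.
  rewrite -ge0_integralZl//; last 2 first.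
  - by move=> w _; rewrite lee_fin normL2_ge0.
  - by rewrite lee_fin normL2_ge0.
  apply: ge0_le_integral => //.
  - by apply: measurableT_comp => //; case/integrableP : iW.
  - exact: emeasurable_funM.
  - by move=> w _; rewrite -EFinM lee_fin -dotL2Bl mulrC ler_normL2_dot.
have lim0 : ((normL2 g)%:E * e n)%E @[n --> \oo] --> 0%E.
  by rewrite -(mule0 (normL2 g)%:E); exact: cvgeZl.
have limd : (`|\int[P]_w dotL2 (U w) g -
    dotL2 (\sum_(x <- s n) fine (P x.1) *: x.2) g|%:E)%E @[n --> \oo] -->
    (`|\int[P]_w dotL2 (U w) g - dotL2 m g|%:E)%E.
  apply: cvg_EFin; first exact: nearW.
  apply: cvg_norm; apply: cvgB; first exact: cvg_cst.
  exact: cvgL2_dotl.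
have : (`|\int[P]_w dotL2 (U w) g - dotL2 m g|%:E <= 0)%E.
  rewrite -(cvg_lim _ limd)// -(cvg_lim _ lim0)//.
  apply: lee_lim; [by apply/cvg_ex; eexists; exact: limd|
    by apply/cvg_ex; eexists; exact: lim0|exact: nearW].
by rewrite lee_fin normr_le0 subr_eq0 => /eqP.
Qed.

End bochner.

Section environment_score.
Context (R : realType) (d : measure_display) (T : measurableType d).
Variables (mu : {finite_measure set T -> \bar R}) (p : nat).
Context (dO : measure_display) (Omega : measurableType dO).
Variables (P : probability Omega R).
Variables (S : L2 mu p.+1 -> L2 mu p.+1) (eps : Vspace P mu p.+1).
Hypothesis heps : bochner_expectation P eps 0.

Definition Vscore (dU : measure_display) (OU : measurableType dU)
    (Q : probability OU R) k (U : Vspace Q mu k) (g : L2 mu k) : L2 Q 1 :=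
  score (@Vspace_joint _ _ _ _ _ _ _ _ U) (Vspace_fin U) g.

Lemma VscoreE (dU : measure_display) (OU : measurableType dU)
  (Q : probability OU R) k (U : Vspace Q mu k) (g : L2 mu k) i w :
  Vscore U g i w = dotL2 (U w) g.
Proof. exact: scoreE. Qed.

Variables (A : Vspace P mu p.+1) (E : environment S eps A).
Variables (h g : L2 mu p.+1).
Hypothesis Sg : forall f, dotL2 (S f) h = dotL2 f g.
Local Notation Q := (env_P E).

(** Here g = S* h, so <(Y, X), h> is almost surely <A, g> + <eps_A, g>. The two terms keep their
    laws from Omega, and their cross moment is the product of two means, one of which is 0. *)
Lemma env_score_sqr :
  dotL2 (Vscore (env_YX E) h) (Vscore (env_YX E) h) =
  dotL2 (Vscore A g) (Vscore A g) + dotL2 (Vscore eps g) (Vscore eps g).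
Proof.
pose a w := dotL2 (A (env_ext E w)) g.
pose e w := dotL2 (env_eps (w : env_space E)) g.
have mA : measurable_fun setT (fun w => dotL2 (A w) g).
  by apply: measurable_borel_dot; exact: (@Vspace_borel _ _ _ _ _ _ _ _ A).
have meps : measurable_fun setT (fun w => dotL2 (eps w) g).
  by apply: measurable_borel_dot; exact: (@Vspace_borel _ _ _ _ _ _ _ _ eps).
have ma : measurable_fun setT a by exact: (measurableT_comp mA).
have me : measurable_fun setT e.
  by apply: measurable_borel_dot; exact: env_eps_borel.
have lawa B : measurable B -> Q (a @^-1` B) = P ((fun w => dotL2 (A w) g) @^-1` B).
  move=> mB; rewrite -(env_extE E)//.
  by rewrite -[X in measurable X]setTI; exact: mA.
have lawe B : measurable B -> Q (e @^-1` B) = P ((fun w => dotL2 (eps w) g) @^-1` B).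
  move=> mB; exact: (env_eps_law E (borelL2_dot g mB)).
have msq : measurable_fun setT (fun x : R => (x ^+ 2)%:E).
  by apply/measurable_EFinP.
have sq0 (x : R) : (0 <= (x ^+ 2)%:E)%E by rewrite lee_fin sqr_ge0.
have a2E : (\int[Q]_w (a w ^+ 2)%:E = (dotL2 (Vscore A g) (Vscore A g))%:E)%E.
  rewrite (ge0_integral_same_law ma mA lawa msq sq0) dotL2E big_ord1.
  by apply: eq_integral => w _; rewrite VscoreE.
have e2E : (\int[Q]_w (e w ^+ 2)%:E = (dotL2 (Vscore eps g) (Vscore eps g))%:E)%E.
  rewrite (ge0_integral_same_law me meps lawe msq sq0) dotL2E big_ord1.
  by apply: eq_integral => w _; rewrite VscoreE.
have ay : (\int[Q]_w (a w ^+ 2)%:E < +oo)%E by rewrite a2E ltry.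
have ey : (\int[Q]_w (e w ^+ 2)%:E < +oo)%E by rewrite e2E ltry.
pose la : L2 Q 1 := [ffun=> mkLfun2 ma ay].
pose le : L2 Q 1 := [ffun=> mkLfun2 me ey].
have laE i w : la i w = a w by rewrite ffunE.
have leE i w : le i w = e w by rewrite ffunE.
have dla : dotL2 la la = dotL2 (Vscore A g) (Vscore A g).
  apply: EFin_inj; rewrite -a2E dotL2E big_ord1.
  by apply: eq_integral => w _; rewrite laE.
have dle : dotL2 le le = dotL2 (Vscore eps g) (Vscore eps g).
  apply: EFin_inj; rewrite -e2E dotL2E big_ord1.
  by apply: eq_integral => w _; rewrite leE.
have ie0 : (\int[Q]_w (e w)%:E = 0)%E.
  have ieps : P.-integrable setT (fun w => (dotL2 (eps w) g)%:E).
    exact: (integrable_score (@Vspace_joint _ _ _ _ _ _ _ _ eps) (Vspace_fin eps)).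
  rewrite (integral_same_law me meps lawe ieps).
  have := bochner_score (@Vspace_joint _ _ _ _ _ _ _ _ eps) (Vspace_fin eps) g heps.
  rewrite dotL20l /Rintegral => e0.
  by rewrite -(fineK (integrable_fin_num measurableT ieps)) e0.
have intL (l : L2 Q 1) : Q.-integrable setT (EFin \o (l ord0 : _ -> R)).
  have fP : Q setT \is a fin_num by exact: fin_num_measure.
  exact/Lfun1_integrable/(Lfun_subset12 fP)/LfunP.
have dae : dotL2 la le = 0.
  rewrite /dotL2 big_ord1 /Rintegral.
  rewrite (@integral_indep_mul _ _ _ Q (la ord0) (le ord0))//.
  - have -> : (\int[Q]_w (le ord0 w)%:E = 0)%E.
      by rewrite -ie0; apply: eq_integral => w _; rewrite leE.
    by rewrite mule0.
  - exact: L2_integrableM.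
  move=> B C mB mC.
  have -> : (la ord0 : _ -> R) = a by apply/funext => w; exact: laE.
  have -> : (le ord0 : _ -> R) = e by apply/funext => w; exact: leE.
  exact: (env_indep E (borelL2_dot g mB) (borelL2_dot g mC)).
have sE : eqL2 (Vscore (env_YX E) h) (la + le).
  move=> i; have := env_YXE E; apply: filterS => w YXw.
  by rewrite VscoreE L2D laE leE (eqL2_dotl _ YXw) Sg dotL2Dl.
rewrite (eqL2_dotl _ sE) dotL2C (eqL2_dotl _ sE) dotL2Dl !dotL2Dr.
by rewrite (dotL2C le la) dae dla dle addr0 add0r.
Qed.

End environment_score.

(** * Normal equations *)

Section square_summable.
Context (R : realType).
Implicit Types (a : nat -> R) (J : set nat).

Lemma nneseries_sqr_le a J (M : R) :
  (forall n, \sum_(l < n | (l : nat) \in J) a l ^+ 2 <= M) ->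
  (\sum_(0 <= l <oo | l \in J) (a l ^+ 2)%:E <= M%:E)%E.
Proof.
move=> aM; apply: lime_le.
  by apply: is_cvg_nneseries_cond => l _ _; rewrite lee_fin sqr_ge0.
by apply: nearW => n; rewrite sumEFin lee_fin big_mkord.
Qed.

Lemma le_nneseries_sqr a J (M : R) :
  (\sum_(0 <= l <oo | l \in J) (a l ^+ 2)%:E <= M%:E)%E ->
  forall n, \sum_(l < n | (l : nat) \in J) a l ^+ 2 <= M.
Proof.
move=> aM n; rewrite -lee_fin; apply: le_trans aM.
rewrite -sumEFin -(big_mkord (fun l => l \in J) (fun l => (a l ^+ 2)%:E)).
by apply: nneseries_lim_ge => l _ _; rewrite lee_fin sqr_ge0.
Qed.

End square_summable.

Section normal_equation.
Context (R : realType) (d : measure_display) (T : measurableType d).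
Variable mu : {finite_measure set T -> \bar R}.
Local Notation mu2 := (mu \x mu)%E.
Variable p : nat.
Implicit Types (b w : L2 mu2 p) (f g v : L2 mu p).

Variable phi : nat -> L2 mu 1.
Hypothesis hphi : orthonormal_basis setT setT phi.

Let phi_on i j : dotL2 (phi i) (phi j) = (i == j)%:R.
Proof. by case: hphi => _ h _ _; exact: h. Qed.

Variables (K : L2 mu p -> L2 mu p) (M : nat -> L2 mu p).
Hypothesis Ksym : forall f g, dotL2 (K f) g = dotL2 f (K g).
Hypothesis KM : forall k f, eqL2 (K f) 0 -> dotL2 (M k) f = 0.

Let ker := [set f : L2 mu p | eqL2 (K f) 0].

(** [padj b (phi k)] is the k-th coefficient function b_k of [b]. The section keeps of the
    statistical model only the symmetry of [K] and the orthogonality of each [M k] to its kernel. *)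
Definition solution b := forall k, eqL2 (K (padj b (phi k))) (M k).

(** By symmetry the kernel is the orthogonal complement of the range of [K]; closedness and
    stability under sums are read off this description. *)
Lemma kerP f : ker f <-> forall v, dotL2 f (K v) = 0.
Proof.
split => [kf v|kf]; first by rewrite -Ksym (eqL2_dotl _ kf) dotL20l.
by apply/eqL2_dotP => v; rewrite Ksym dotL20l.
Qed.

Lemma ker_cvg (u : nat -> L2 mu p) f :
  (forall n, ker (u n)) -> u @ \oo --> f -> ker f.
Proof.
move=> ku uf; apply/kerP => v.
have := cvgL2_dotl (g := K v) uf.
rewrite (_ : (fun n => _) = cst 0); last first.
  by apply/funext => n; exact: (kerP _).1.
by move=> h; rewrite -(cvg_lim (@Rhausdorff R) h); exact: lim_cst.
Qed.

Lemma ker_sum (c : nat -> R) (J : set nat) (e : nat -> L2 mu p) n :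
  (forall l, J l -> ker (e l)) ->
  ker (\sum_(l < n | (l : nat) \in J) c l *: e l).
Proof.
move=> ke; apply/kerP => v; rewrite dotL2_suml big1// => l /set_mem Jl.
by rewrite dotL2Zl ((kerP _).1 (ke _ Jl)) mulr0.
Qed.

Variables (Jpsi Jeta : set nat) (psi eta : nat -> L2 mu p).
Hypothesis psi_eigen : forall l, Jpsi l ->
  exists2 lambda : R, lambda != 0 & eqL2 (lambda *: psi l) (K (psi l)).
Hypothesis hpsi : orthonormal_basis (orthoL2 ker) Jpsi psi.
Hypothesis heta : orthonormal_basis ker Jeta eta.

(** Any v splits into its expansion along [eta] and a remainder orthogonal to the kernel, to which
    the expansion along [psi] applies. *)
Lemma eqL2_on_bases f g : (forall v, ker v -> dotL2 f v = dotL2 g v) ->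
  (forall l, Jpsi l -> dotL2 f (psi l) = dotL2 g (psi l)) -> eqL2 f g.
Proof.
case: hpsi => _ onpsi _ cpsi; case: heta => _ oneta eker ceta.
move=> fgker fgpsi; apply/eqL2_dotP => v.
have [vk vkP] := orthonormal_series_cvg oneta
  (c := fun l => dotL2 v (eta l)) (bessel oneta v).
have kvk : ker vk.
  by apply: ker_cvg vkP => n; exact: (@ker_sum (fun l => dotL2 v (eta l))).
have ovp : orthoL2 ker (v - vk).
  move=> u ku; have := cvgL2_dotl (g := v - vk) (ceta _ ku).
  rewrite (_ : (fun n => _) = cst 0) => [h|].
    rewrite dotL2C -(cvg_lim (@Rhausdorff R) h); exact: lim_cst.
  apply/funext => n; rewrite dotL2_suml big1// => l /set_mem Jl.
  rewrite dotL2Zl (dotL2C (eta l)) dotL2Bl.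
  by rewrite (orthonormal_series_dot
    (c := fun l => dotL2 v (eta l)) oneta Jl vkP) subrr mulr0.
have vp0 : dotL2 (v - vk) (f - g) = 0.
  have := cvgL2_dotl (g := f - g) (cpsi _ ovp).
  rewrite (_ : (fun n => _) = cst 0) => [h|].
    by rewrite -(cvg_lim (@Rhausdorff R) h); exact: lim_cst.
  apply/funext => n; rewrite dotL2_suml big1// => l /set_mem Jl.
  by rewrite dotL2Zl (dotL2C (psi l)) dotL2Bl fgpsi// subrr mulr0.
apply/eqP; rewrite -subr_eq0 -dotL2Bl dotL2C -[v](subrK vk) dotL2Dl vp0 add0r.
by rewrite dotL2C dotL2Bl fgker// subrr.
Qed.

(** If K psi_l = lambda_l psi_l, this is <M_k, psi_l> / lambda_l, as psi_l is a unit vector; the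
    form without lambda_l matches [coef]. *)
Let c k l := dotL2 (M k) (psi l) / dotL2 (K (psi l)) (psi l).

Lemma coef_eigen k l (lambda : R) : Jpsi l -> lambda != 0 ->
  eqL2 (lambda *: psi l) (K (psi l)) -> lambda * c k l = dotL2 (M k) (psi l).
Proof.
move=> Jl l0 el; case: hpsi => _ onpsi _ _.
rewrite /c -(eqL2_dotl _ el) dotL2Zl onpsi// eqxx mulr1.
by rewrite mulrC divfK.
Qed.

(** Pairing with psi_l gives <M_k, psi_l> = <K b_k, psi_l> = lambda_l <b_k, psi_l>, and lambda_l is
    not 0. *)
Lemma solution_coef b k l : solution b -> Jpsi l ->
  c k l = dotL2 (padj b (phi k)) (psi l).
Proof.
move=> sb Jl; have [lambda l0 el] := psi_eigen Jl.
apply: (mulfI l0); rewrite (coef_eigen k Jl l0 el) -(eqL2_dotl _ (sb k)) Ksym.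
by rewrite dotL2C -(eqL2_dotl _ el) dotL2Zl dotL2C.
Qed.

(** Bessel bounds the squares in the k-th row of [c] by |b_k|^2, and these add up to |b|^2. *)
Lemma solution_summable b : solution b -> summable2 c Jpsi.
Proof.
move=> sb; case: hpsi => _ onpsi _ _.
apply: (@le_lt_trans _ _ (dotL2 b b)%:E); last exact: ltry.
rewrite -(padj_parseval hphi); apply: lee_nneseries => [i _ _|i _].
  by apply: nneseries_ge0 => l _ _; rewrite lee_fin sqr_ge0.
apply: nneseries_sqr_le => n; apply: le_trans (bessel onpsi (padj b (phi i)) n).
rewrite le_eqVlt; apply/orP; left; apply/eqP; apply: eq_bigr => l /set_mem Jl.
by rewrite (solution_coef _ sb Jl).
Qed.

(** The rows sum to vectors x_i by orthonormality of [psi], and the tensors phi_i (x) x_i are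
    orthogonal with summable squared norms. The normal equations are then checked on the kernel and
    on each psi_l. *)
Lemma summable_solution : summable2 c Jpsi ->
  exists2 b, tensor_series c phi Jpsi psi b & solution b.
Proof.
rewrite /summable2 => sc; case: (hpsi) => _ onpsi _ _.
pose Sc i := (\sum_(0 <= l <oo | l \in Jpsi) (c i l ^+ 2)%:E)%E.
have Sc0 i : (0 <= Sc i)%E.
  by apply: nneseries_ge0 => l _ _; rewrite lee_fin sqr_ge0.
have Scfin i : Sc i \is a fin_num.
  rewrite ge0_fin_numE//; apply: le_lt_trans sc.
  rewrite (@nneseriesD1 _ Sc i xpredT)// leeDl//.
  by apply: nneseries_ge0 => *; exact: Sc0.
have bc i : forall n, \sum_(l < n | (l : nat) \in Jpsi) c i l ^+ 2 <= fine (Sc i).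
  by apply: le_nneseries_sqr; rewrite fineK.
have /choice[x xP] := fun i => orthonormal_series_cvg onpsi (c := c i) (bc i).
have xx i : dotL2 (x i) (x i) <= fine (Sc i).
  have h := cvgL2_sqr (xP i).
  rewrite -(cvg_lim (@Rhausdorff R) h); apply: limr_le.
    by apply/cvg_ex; eexists; exact: h.
  by apply: nearW => n; rewrite (orthonormal_sqr onpsi).
have [b bP] : exists b, (\sum_(i < n) tensorL2 (phi i) (x i)) @[n --> \oo] --> b.
  apply: (@orthogonal_series_cvg _ _ _ _ _ (fun i => tensorL2 (phi i) (x i))
    (fine (\sum_(i <oo) Sc i)%E)).
    by move=> i j ij; rewrite dot_tensorL2 phi_on (negbTE ij) mul0r.
  move=> n; rewrite -lee_fin fineK; last first.
    by rewrite ge0_fin_numE//; apply: nneseries_ge0 => *; exact: Sc0.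
  apply: (@le_trans _ _ (\sum_(0 <= i < n) Sc i)%E); last first.
    by apply: nneseries_lim_ge => *; exact: Sc0.
  rewrite -sumEFin big_mkord; apply: lee_sum => i _.
  by rewrite dot_tensorL2 phi_on eqxx mul1r -(fineK (Scfin i)) lee_fin.
exists b.
  exists (fun i => tensorL2 (phi i) (x i)); split=> // i.
  rewrite (_ : (fun n => _) = (fun n => tensorL2 (phi i)
    (\sum_(l < n | (l : nat) \in Jpsi) c i l *: psi l))).
    exact: cvg_tensorL2.
  apply/funext => n; rewrite tensorL2_sum; apply: eq_bigr => l _.
  by rewrite tensorL2Zr.
(* Thus [padj b (phi k)] is x_k: the other tensors are orthogonal to phi_k (x) v, so the inner
   products are constant from n = k + 1 on. *)
have bx k v : dotL2 (padj b (phi k)) v = dotL2 (x k) v.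
  rewrite dot_padj_tensor.
  have h := cvgL2_dotl (g := tensorL2 (phi k) v) bP.
  rewrite -(cvg_lim (@Rhausdorff R) h); apply: cvg_lim => //.
  apply: cvg_near_cst; exists k.+1 => // n /= kn.
  rewrite dotL2_suml (bigD1 (Ordinal kn))//= dot_tensorL2 phi_on eqxx mul1r.
  rewrite big1 ?addr0// => i ik; rewrite dot_tensorL2 phi_on.
  by rewrite (_ : (i == k :> nat) = false) ?mul0r//; exact/negbTE.
(* On the kernel both sides vanish, the right one by [KM]; along psi_l both equal lambda_l
   c_{k,l}. *)
move=> k; apply: eqL2_on_bases => [v kv|l Jl].
  by rewrite Ksym dotL2C (eqL2_dotl _ kv) dotL20l KM.
have [lambda l0 el] := psi_eigen Jl.
rewrite -(coef_eigen k Jl l0 el) Ksym bx.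
rewrite dotL2C -(eqL2_dotl _ el) dotL2Zl dotL2C.
by rewrite (orthonormal_series_dot (c := c k) onpsi Jl (xP k)).
Qed.

(** Symmetry moves [K] to the test function, after which additivity of [padj] in its kernel
    suffices. *)
Lemma solution_diff b0 b : solution b0 ->
  (solution b <-> forall k, ker (padj (b - b0) (phi k))).
Proof.
move=> s0; have E k v : dotL2 (padj (b - b0) (phi k)) (K v) =
    dotL2 (K (padj b (phi k))) v - dotL2 (M k) v.
  by rewrite dot_padjB -!Ksym (eqL2_dotl _ (s0 k)).
split => [sb k|kb k].
  by apply/kerP => v; rewrite E (eqL2_dotl _ (sb k)) subrr.
apply/eqL2_dotP => v; apply/eqP; rewrite -subr_eq0 -E.
by rewrite ((kerP _).1 (kb k)).
Qed.

(** The coefficients <padj w phi_k, eta_l> are square-summable by Bessel and [padj_parseval], and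
    [tensor_expansion] sums the series back to [w]. *)
Lemma ker_tensor_span w : (forall k, ker (padj w (phi k))) ->
  tensor_span phi Jeta eta w.
Proof.
case: heta => _ oneta _ ceta kw.
exists (fun k l => dotL2 (padj w (phi k)) (eta l)); split.
  rewrite /summable2 (@le_lt_trans _ _ (dotL2 w w)%:E)//; last exact: ltry.
  rewrite -(padj_parseval hphi); apply: lee_nneseries => [i _ _|i _].
    by apply: nneseries_ge0 => l _ _; rewrite lee_fin sqr_ge0.
  by apply: nneseries_sqr_le => n; exact: bessel.
exists (fun k => tensorL2 (phi k) (padj w (phi k))); split; last first.
  exact: tensor_expansion.
move=> i; rewrite (_ : (fun n => _) = (fun n => tensorL2 (phi i)
  (\sum_(l < n | (l : nat) \in Jeta) dotL2 (padj w (phi i)) (eta l) *: eta l))).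
  by apply: cvg_tensorL2; exact: ceta.
apply/funext => n; rewrite tensorL2_sum; apply: eq_bigr => l _.
by rewrite tensorL2Zr.
Qed.

(** Each phi_i (x) eta_l is orthogonal to phi_k (x) K v, and this passes to both limits of the
    iterated series. *)
Lemma tensor_span_ker w k : tensor_span phi Jeta eta w -> ker (padj w (phi k)).
Proof.
case: heta => _ _ keta _ [alpha [_ [s [sP wP]]]].
apply/kerP => v; rewrite dot_padj_tensor.
have s0 i : dotL2 (s i) (tensorL2 (phi k) (K v)) = 0.
  have h := cvgL2_dotl (g := tensorL2 (phi k) (K v)) (sP i).
  rewrite -(cvg_lim (@Rhausdorff R) h) (_ : (fun n => _) = cst 0); last first.
    apply/funext => n; rewrite dotL2_suml big1// => l /set_mem Jl.
    by rewrite dotL2Zl dot_tensorL2 ((kerP _).1 (keta _ Jl)) !mulr0.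
  exact: lim_cst.
have h := cvgL2_dotl (g := tensorL2 (phi k) (K v)) wP.
rewrite -(cvg_lim (@Rhausdorff R) h) (_ : (fun n => _) = cst 0); last first.
  by apply/funext => n; rewrite dotL2_suml big1.
exact: lim_cst.
Qed.

End normal_equation.

(** * Risk in the environments *)

Section head_tail.
Context (R : realType) (d : measure_display) (T : measurableType d).
Variables (mu : {measure set T -> \bar R}) (p : nat).
Implicit Types (u : L2 mu p.+1) (y : L2 mu 1) (x : L2 mu p).

Definition headL2 u : L2 mu 1 := [ffun=> u ord0].
Definition tailL2 u : L2 mu p := [ffun i => u (lift ord0 i)].
(** [liftY] and [liftX] are the adjoints of [headL2] and [tailL2], so the scores of Y and of X are
    scores of the pair (Y, X). *)
Definition liftY y : L2 mu p.+1 := [ffun i => if unlift ord0 i is Some _ then 0 else y ord0].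
Definition liftX x : L2 mu p.+1 := [ffun i => if unlift ord0 i is Some j then x j else 0].

Lemma dot_liftY u y : dotL2 u (liftY y) = dotL2 (headL2 u) y.
Proof.
rewrite /dotL2 big_ord_recl big_ord1 [X in _ + X]big1 ?addr0.
  by apply: eq_Rintegral => t _; rewrite !ffunE unlift_none.
move=> i _; rewrite /Rintegral integral0_eq// => t _.
by rewrite ffunE liftK mulr0.
Qed.

Lemma dot_liftX u x : dotL2 u (liftX x) = dotL2 (tailL2 u) x.
Proof.
rewrite /dotL2 big_ord_recl.
rewrite [X in X + _](_ : _ = 0) ?add0r.
  by apply: eq_bigr => i _; apply: eq_Rintegral => t _; rewrite !ffunE liftK.
by rewrite /Rintegral integral0_eq// => t _; rewrite ffunE unlift_none mulr0.
Qed.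

Lemma dot_head_tail u : dotL2 u u = dotL2 (headL2 u) (headL2 u) + dotL2 (tailL2 u) (tailL2 u).
Proof.
rewrite /dotL2 big_ord_recl big_ord1; congr (_ + _).
  by apply: eq_Rintegral => t _; rewrite ffunE.
by apply: eq_bigr => i _; apply: eq_Rintegral => t _; rewrite ffunE.
Qed.

Lemma liftXD x x' : liftX (x + x') = liftX x + liftX x'.
Proof.
apply/ffunP => i; apply/LfuneqP => t; rewrite L2D !ffunE.
by case: (unlift _ _) => [j|]; rewrite ?ffunE//= ?addr0.
Qed.

Lemma liftXZ a x : liftX (a *: x) = a *: liftX x.
Proof.
apply/ffunP => i; apply/LfuneqP => t; rewrite L2Z !ffunE.
by case: (unlift _ _) => [j|]; rewrite ?ffunE//= ?mulr0.
Qed.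

Lemma liftXB x x' : liftX (x - x') = liftX x - liftX x'.
Proof. by rewrite -scaleN1r liftXD liftXZ scaleN1r. Qed.

End head_tail.

Section pint_residual.
Context (R : realType) (d : measure_display) (T : measurableType d).
Variables (mu : {finite_measure set T -> \bar R}) (p : nat).

Lemma dot_pint_residual_le (b : L2 (mu \x mu)%E p) (u : L2 mu p.+1) :
  dotL2 (headL2 u - pintL2 b (tailL2 u)) (headL2 u - pintL2 b (tailL2 u)) <=
  (2 + 2 * dotL2 b b) * dotL2 u u.
Proof.
rewrite (dot_head_tail u).
move: (headL2 u) (tailL2 u) => y x.
have h1 := normL2_pint b x.
have h2 := ler_normL2_dot y (pintL2 b x).
have h3 : normL2 (pintL2 b x) ^+ 2 <= normL2 b ^+ 2 * normL2 x ^+ 2.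
  by rewrite -exprMn ler_sqr ?nnegrE ?mulr_ge0 ?normL2_ge0.
rewrite ler_norml in h2; case/andP: h2 => h2 _.
rewrite -(normL2_sqr (y - pintL2 b x)) normL2B_sqr -(normL2_sqr b) -(normL2_sqr y) -(normL2_sqr x).
move: h2 h3; move: (dotL2 y _) => yq.
move: (normL2 y) (normL2 x) (normL2 (pintL2 _ _)) (normL2 b) => {h1} ny nx q nb h2 h3.
have := sqr_ge0 (ny - q); have := sqr_ge0 ny; have := sqr_ge0 nx.
have := mulr_ge0 (sqr_ge0 nb) (sqr_ge0 ny).
by rewrite sqrrB -mulr_natr; lra.
Qed.

End pint_residual.

Section one_environment.
Context (R : realType) (d : measure_display) (T : measurableType d).
Variables (mu : {finite_measure set T -> \bar R}) (p : nat).
Local Notation mu2 := (mu \x mu)%E.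
Context (dO : measure_display) (Omega : measurableType dO).
Variables (P : probability Omega R).
Variables (S : L2 mu p.+1 -> L2 mu p.+1) (eps : Vspace P mu p.+1).
Variables (A : Vspace P mu p.+1) (E : environment S eps A).

Definition env_score (h : L2 mu p.+1) : L2 (env_P E) 1 := Vscore (env_YX E) h.

Lemma env_scoreE h i w : env_score h i w = dotL2 (env_YX E w) h.
Proof. exact: VscoreE. Qed.

Lemma env_scoreD h h' : env_score (h + h') = env_score h + env_score h'.
Proof. exact: scoreD. Qed.

Lemma env_scoreZ a h : env_score (a *: h) = a *: env_score h.
Proof. exact: scoreZ. Qed.

Lemma env_score_eq h h' : eqL2 h h' -> env_score h = env_score h'.
Proof.
move=> hh'; apply/ffunP => i; apply/LfuneqP => w.
by rewrite !env_scoreE dotL2C (eqL2_dotl _ hh') dotL2C.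
Qed.

Lemma env_score_liftY i y w : env_score (liftY p y) i w = dotL2 (env_Y w) y.
Proof. by rewrite env_scoreE dot_liftY. Qed.

Lemma env_score_liftX i x w : env_score (liftX x) i w = dotL2 (env_X w) x.
Proof. by rewrite env_scoreE dot_liftX. Qed.

Lemma cross_momentE y x :
  cross_moment E y x = dotL2 (env_score (liftY p y)) (env_score (liftX x)).
Proof.
rewrite /cross_moment unlock /dotL2 big_ord1; congr fine.
by apply: eq_integral => w _; rewrite env_score_liftY env_score_liftX.
Qed.

Lemma square_momentE x :
  square_moment E x = dotL2 (env_score (liftX x)) (env_score (liftX x)).
Proof.
rewrite /square_moment unlock {2}/dotL2 big_ord1; congr fine.
by apply: eq_integral => w _; rewrite env_score_liftX expr2.
Qed.

Lemma env_X_joint i :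
  measurable_fun setT (fun z : env_space E * T => env_X z.1 i z.2).
Proof.
rewrite (_ : (fun z => _) = (fun z => env_YX E z.1 (lift ord0 i) z.2)).
  exact: (Vspace_joint (env_YX E)).
by apply/funext => z; rewrite ffunE.
Qed.

Lemma env_X_fin : (sqnormV (env_P E) (@env_X _ _ _ _ _ _ _ _ _ _ _ E) < +oo)%E.
Proof.
apply: le_lt_trans (Vspace_fin (env_YX E)).
rewrite /sqnormV [leRHS]big_ord_recl.
apply: (@le_trans _ _ (\sum_(i < p) \int[mu]_t
    'E_(env_P E)[fun w => (env_YX E w (lift ord0 i) t ^+ 2)%R])%E).
  rewrite le_eqVlt; apply/orP; left; apply/eqP; apply: eq_bigr => i _.
  apply: eq_integral => t _; congr expectation; apply/funext => w.
  by rewrite ffunE.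
rewrite leeDr//; apply: integral_ge0 => t _; rewrite unlock.
by apply: integral_ge0 => w _; rewrite lee_fin sqr_ge0.
Qed.

(* The Riesz representative of v |-> E[<YX, h> <X, v>]. *)
Definition env_cov (h : L2 mu p.+1) : L2 mu p :=
  padj (joint env_X_joint env_X_fin) (env_score h).

Lemma score_env_X f : score env_X_joint env_X_fin f = env_score (liftX f).
Proof.
by apply/ffunP => i; apply/LfuneqP => w; rewrite scoreE env_score_liftX.
Qed.

Lemma dot_env_cov h v :
  dotL2 (env_cov h) v = dotL2 (env_score h) (env_score (liftX v)).
Proof. by rewrite -dot_pint_padj -score_env_X dotL2C. Qed.

Lemma ae_env_kernel (f : L2 mu p) j : {ae mu, forall t,
  \int[mu]_s (\row_i f i s *m moment_kernel (env_P E) (@env_X _ _ _ _ _ _ _ _ _ _ _ E) s t) 0 j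
   = env_cov (liftX f) j t}.
Proof.
have := ae_kernel_row env_X_joint env_X_fin f j; apply: filterS => t ->.
by rewrite score_env_X.
Qed.

Variable phi : nat -> L2 mu 1.
Hypothesis hphi : orthonormal_basis setT setT phi.

Definition residual (b : L2 mu2 p) (k : nat) : L2 mu p.+1 :=
  liftY p (phi k) - liftX (padj b (phi k)).

Let r b (w : env_space E) : L2 mu 1 := env_Y w - pintL2 b (env_X w).

Let riskE b : (risk E b = \int[env_P E]_w (dotL2 (r b w) (r b w))%:E)%E.
Proof.
apply: eq_integral => w _; rewrite dotL2E big_ord1; apply: eq_integral => t _.
by rewrite L2D L2N pintL2E.
Qed.

Let r_residual b w k : dotL2 (r b w) (phi k) = dotL2 (env_YX E w) (residual b k).
Proof.
rewrite dotL2Bl dotL2Br dot_liftY dot_liftX dot_pint_padj.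
by rewrite (dotL2C (padj _ _)).
Qed.

Lemma risk_series b : (risk E b =
  \sum_(k <oo) (dotL2 (env_score (residual b k)) (env_score (residual b k)))%:E)%E.
Proof.
rewrite riskE (eq_integral (fun w => \sum_(k <oo)
    ((env_score (residual b k) ord0 w) ^+ 2)%:E)%E); last first.
  move=> w _; rewrite -(basis_parseval hphi); apply: eq_eseriesr => k _.
  by rewrite r_residual env_scoreE.
rewrite integral_nneseries//; last 2 first.
- move=> k; apply/measurable_EFinP/measurable_funX; exact: measurable_Lfun2.
- by move=> k w _; rewrite lee_fin sqr_ge0.
by apply: eq_eseriesr => k _; rewrite dotL2E big_ord1.
Qed.

Lemma risk_lty b : (risk E b < +oo)%E.
Proof.
(* Measurability of the squared residual comes from its Parseval series, whose terms are squares of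
   scores. *)
have mr : measurable_fun setT (fun w => (dotL2 (r b w) (r b w))%:E).
  rewrite (_ : (fun w => _) = (fun w => \sum_(k <oo)
    ((env_score (residual b k) ord0 w) ^+ 2)%:E)%E); last first.
    apply/funext => w; rewrite -(basis_parseval hphi); apply: eq_eseriesr => k _.
    by rewrite r_residual env_scoreE.
  apply: ge0_emeasurable_sum => [k w _ _|k _]; first by rewrite lee_fin sqr_ge0.
  apply/measurable_EFinP/measurable_funX; exact: measurable_Lfun2.
pose C : R := 2 + 2 * dotL2 b b.
have C0 : 0 <= C by rewrite addr_ge0// mulr_ge0// dotL2_ge0.
have mU i : measurable_fun setT
    (fun z : env_space E * T => ((env_YX E z.1 i z.2) ^+ 2)%:E).
  by apply/measurable_EFinP/measurable_funX; exact: (Vspace_joint (env_YX E)).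
have mYX : measurable_fun setT (fun w => (dotL2 (env_YX E w) (env_YX E w))%:E).
  rewrite (_ : (fun w => _) =
    (fun w => \sum_(i < p.+1) \int[mu]_t ((env_YX E w i t) ^+ 2)%:E)%E); last first.
    by apply/funext => w; rewrite dotL2E.
  apply: emeasurable_sum => i.
  apply: (measurable_fun_fubini_tonelli_F
    (fun z : env_space E * T => ((env_YX E z.1 i z.2) ^+ 2)%:E)) => //.
  by move=> z; rewrite lee_fin sqr_ge0.
rewrite riskE; apply: (@le_lt_trans _ _
  (\int[env_P E]_w (C%:E * (dotL2 (env_YX E w) (env_YX E w))%:E))%E).
  apply: ge0_le_integral => //.
  - by move=> w _; rewrite lee_fin dotL2_ge0.
  - exact: emeasurable_funM.
  by move=> w _; rewrite -EFinM lee_fin; exact: dot_pint_residual_le.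
rewrite ge0_integralZl//; last by move=> w _; rewrite lee_fin dotL2_ge0.
rewrite lte_mul_pinfty//; rewrite (eq_integral (fun w =>
  \sum_(i < p.+1) \int[mu]_t ((env_YX E w i t) ^+ 2)%:E)%E); last first.
  by move=> w _; rewrite dotL2E.
rewrite ge0_integral_sum//; last 2 first.
- move=> i; apply: (measurable_fun_fubini_tonelli_F
    (fun z : env_space E * T => ((env_YX E z.1 i z.2) ^+ 2)%:E)) => //.
  by move=> z; rewrite lee_fin sqr_ge0.
- by move=> i w _; apply: integral_ge0 => t _; rewrite lee_fin sqr_ge0.
apply: lte_sum_pinfty => i _.
rewrite -(fubini_tonelli1 (fun z => ((env_YX E z.1 i z.2) ^+ 2)%:E))//.
  exact: (joint_lty (Vspace_joint (env_YX E)) (Vspace_fin (env_YX E))).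
by move=> z; rewrite lee_fin sqr_ge0.
Qed.

End one_environment.

(** * The worst risk as a series of values of a quadratic form *)

Section worst_risk.
Context (R : realType) (d : measure_display) (T : measurableType d).
Variables (mu : {finite_measure set T -> \bar R}) (p : nat).
Local Notation mu2 := (mu \x mu)%E.
Context (dO : measure_display) (Omega : measurableType dO).
Variables (P : probability Omega R).
Variables (D : set (L2 mu p.+1)) (Top S : L2 mu p.+1 -> L2 mu p.+1).
Hypothesis hS : structural_operator D Top S.
Variable eps : Vspace P mu p.+1.
Hypothesis heps : bochner_expectation P eps 0.
Variable env : forall A : Vspace P mu p.+1, environment S eps A.
Variables (A : Vspace P mu p.+1) (gamma : R).
Hypothesis hgamma : 0 < gamma.
Local Notation EA := (env A).
Local Notation EO := (env (Vspace_zero P mu p.+1)).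

Lemma structural_adjoint : exists Sadj : L2 mu p.+1 -> L2 mu p.+1,
  forall h f, dotL2 (S f) h = dotL2 f (Sadj h).
Proof.
have [M hM] := so_bounded hS.
suff /choice[Sadj SadjP] : forall h, exists g, forall f, dotL2 (S f) h = dotL2 f g.
  by exists Sadj => h f; exact: SadjP.
move=> h; apply: (@L2_riesz _ _ _ _ _ (fun f => dotL2 (S f) h) (M * normL2 h)).
  move=> a f g; rewrite (eqL2_dotl _ (so_linear hS a f g)).
  by rewrite dotL2Dl dotL2Zl.
move=> f; rewrite (le_trans (ler_normL2_dot _ _))// mulrAC.
by rewrite ler_wpM2r ?normL2_ge0.
Qed.

Definition mixed_form (h h' : L2 mu p.+1) : R :=
  gamma * dotL2 (env_score EA h) (env_score EA h') +
  (1 - gamma) * dotL2 (env_score EO h) (env_score EO h').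

Lemma mixed_formC h h' : mixed_form h h' = mixed_form h' h.
Proof.
by rewrite /mixed_form (dotL2C (env_score EA h)) (dotL2C (env_score EO h)).
Qed.

Lemma mixed_formDl h1 h2 h : mixed_form (h1 + h2) h = mixed_form h1 h + mixed_form h2 h.
Proof. rewrite /mixed_form !env_scoreD !dotL2Dl; ring. Qed.

Lemma mixed_formZl a h1 h : mixed_form (a *: h1) h = a * mixed_form h1 h.
Proof. rewrite /mixed_form !env_scoreZ !dotL2Zl; ring. Qed.

Lemma mixed_formBl h1 h2 h : mixed_form (h1 - h2) h = mixed_form h1 h - mixed_form h2 h.
Proof. by rewrite -scaleN1r mixed_formDl mixed_formZl mulN1r. Qed.

Lemma mixed_formDr h1 h2 h : mixed_form h (h1 + h2) = mixed_form h h1 + mixed_form h h2.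
Proof. by rewrite mixed_formC mixed_formDl !(mixed_formC h). Qed.

Lemma mixed_formZr a h1 h : mixed_form h (a *: h1) = a * mixed_form h h1.
Proof. by rewrite mixed_formC mixed_formZl (mixed_formC h). Qed.

Lemma mixed_formBr h1 h2 h : mixed_form h (h1 - h2) = mixed_form h h1 - mixed_form h h2.
Proof. by rewrite mixed_formC mixed_formBl !(mixed_formC h). Qed.

Lemma mixed_form_eq h1 h2 h : eqL2 h1 h2 -> mixed_form h1 h = mixed_form h2 h.
Proof. by move=> h12; rewrite /mixed_form !(env_score_eq _ h12). Qed.

Lemma mixed_form_eq2 h1 h2 : eqL2 h1 h2 -> mixed_form h1 h1 = mixed_form h2 h2.
Proof. by move=> h12; rewrite (mixed_form_eq _ h12) mixed_formC (mixed_form_eq _ h12). Qed.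

Lemma mixed_form_subZ x s y : mixed_form (x - s *: y) (x - s *: y) =
  mixed_form x x - 2 * s * mixed_form x y + s ^+ 2 * mixed_form y y.
Proof.
rewrite mixed_formBl !mixed_formBr !mixed_formZl !mixed_formZr (mixed_formC y x).
ring.
Qed.

Section adjoint.
Variable Sadj : L2 mu p.+1 -> L2 mu p.+1.
Hypothesis SadjP : forall h f, dotL2 (S f) h = dotL2 f (Sadj h).

Lemma env_score_decomp (A' : Vspace P mu p.+1) h :
  dotL2 (env_score (env A') h) (env_score (env A') h) =
  kernel_form P A' (Sadj h) + kernel_form P eps (Sadj h).
Proof.
rewrite (kernel_formE (@Vspace_joint _ _ _ _ _ _ _ _ A') (Vspace_fin A')).
rewrite (kernel_formE (@Vspace_joint _ _ _ _ _ _ _ _ eps) (Vspace_fin eps)).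
exact: (env_score_sqr heps (env A') (SadjP h)).
Qed.

Lemma kernel_form_ge0 (A' : Vspace P mu p.+1) g : 0 <= kernel_form P A' g.
Proof.
rewrite (kernel_formE (@Vspace_joint _ _ _ _ _ _ _ _ A') (Vspace_fin A')).
exact: dotL2_ge0.
Qed.

Lemma kernel_form_zero g : kernel_form P (Vspace_zero P mu p.+1) g = 0.
Proof.
rewrite (kernel_formE (@Vspace_joint _ _ _ _ _ _ _ _ (Vspace_zero P mu p.+1))
  (Vspace_fin (Vspace_zero P mu p.+1))).
rewrite (_ : score _ _ g = 0) ?dotL20l//.
apply/ffunP => i; apply/LfuneqP => w; rewrite scoreE dotL20l.
by rewrite ffunE.
Qed.

Lemma mixed_formE h : mixed_form h h =
  gamma * kernel_form P A (Sadj h) + kernel_form P eps (Sadj h).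
Proof.
rewrite /mixed_form (env_score_decomp A) (env_score_decomp (Vspace_zero P mu p.+1)).
rewrite kernel_form_zero; ring.
Qed.

End adjoint.

Lemma mixed_form_ge0 h : 0 <= mixed_form h h.
Proof.
have [Sadj SadjP] := structural_adjoint.
by rewrite (mixed_formE SadjP) addr_ge0 ?kernel_form_ge0// mulr_ge0 ?kernel_form_ge0// ltW.
Qed.

(** The polynomial B(h + t h', h + t h') in t has no constant term, so its nonnegativity kills the
    linear one. *)
Lemma mixed_form_degenerate h h' : mixed_form h h = 0 -> mixed_form h' h = 0.
Proof.
move=> hh0; apply: (@quad_ge0_eq0 _ (mixed_form h' h')) => t.
have := mixed_form_ge0 (h + t *: h').
rewrite mixed_formDl !mixed_formDr !mixed_formZl !mixed_formZr hh0.
by rewrite (mixed_formC h h'); lra.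
Qed.

Lemma poweR12_lt_sqr (x : \bar R) (e : R) : 0 < e -> (0 <= x)%E ->
  (x `^ 2^-1 < e%:E)%E -> (x <= (e ^+ 2)%:E)%E.
Proof.
move=> e0; case: x => [x| |]//; last first.
  by move=> _; rewrite poweRyr// ltNge leey.
rewrite lee_fin => x0; rewrite poweR12_sqrt//= lte_fin => xe.
rewrite lee_fin -(sqr_sqrtr x0) ler_sqr ?nnegrE ?sqrtr_ge0// ?ltW//.
Qed.

Section difference.
Variables (A1 A2 : Vspace P mu p.+1) (a : R).
Let W (w : Omega) : L2 mu p.+1 := A1 w - a *: A2 w.

Let jW i : measurable_fun setT (fun z : Omega * T => W z.1 i z.2).
Proof.
rewrite (_ : (fun z => _) = (fun z => A1 z.1 i z.2 - a * A2 z.1 i z.2)).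
  apply: measurable_funB; first exact: (Vspace_joint A1).
  by apply: measurable_funM => //; exact: (Vspace_joint A2).
by apply/funext => z; rewrite L2D L2N L2Z.
Qed.

(** The map U -> <U, g> is Lipschitz with constant |g| from V to L^2(P): the norm bound of [pintL2]
    is applied to the kernel of the difference. *)
Lemma Vscore_diff (e : R) g : 0 < e -> (sqnormV P W `^ 2^-1 < e%:E)%E ->
  normL2 (a *: Vscore A2 g) <= normL2 (Vscore A1 g) + e * normL2 g.
Proof.
move=> e0 We.
have W0 : (0 <= sqnormV P W)%E.
  apply: sume_ge0 => i _; apply: integral_ge0 => t _; rewrite unlock.
  by apply: integral_ge0 => w _; rewrite lee_fin sqr_ge0.
have We2 := poweR12_lt_sqr e0 W0 We.
have fW : (sqnormV P W < +oo)%E by apply: le_lt_trans We2 (ltry _).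
have E : score jW fW g = Vscore A1 g - a *: Vscore A2 g.
  apply/ffunP => i; apply/LfuneqP => w.
  by rewrite L2D L2N L2Z scoreE !VscoreE dotL2Bl dotL2Zl.
have nW : normL2 (score jW fW g) <= e * normL2 g.
  apply: (le_trans (normL2_pint _ _)); rewrite ler_wpM2r ?normL2_ge0//.
  rewrite -ler_sqr ?nnegrE ?normL2_ge0 ?(ltW e0)// normL2_sqr -lee_fin.
  by rewrite dot_joint.
have -> : a *: Vscore A2 g = Vscore A1 g - score jW fW g by rewrite E subKr.
by rewrite (le_trans (normL2D _ _))// lerD2l normL2N.
Qed.

End difference.

Variable calA : set (Vspace P mu p.+1).
Hypothesis hC : closureV (shift_set gamma calA A) (fun w => Num.sqrt gamma *: A w).
Variable phi : nat -> L2 mu 1.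
Hypothesis hphi : orthonormal_basis setT setT phi.
Local Notation h := (residual phi).

Let mixed0 b k : (0 <= (mixed_form (h b k) (h b k))%:E)%E.
Proof. by rewrite lee_fin mixed_form_ge0. Qed.

(** The defining inequality of the shift set bounds each term of the risk. Conversely, a partial sum
    involves finitely many scores, and [hC] provides A' in the set whose scores are close to those
    of sqrt(gamma) A. *)
Lemma worst_riskE b : (worst_risk env (shift_set gamma calA A) b =
  \sum_(k <oo) (mixed_form (h b k) (h b k))%:E)%E.
Proof.
have [Sadj SadjP] := structural_adjoint.
have kernelV (A' : Vspace P mu p.+1) g :
    kernel_form P A' g = dotL2 (Vscore A' g) (Vscore A' g).
  exact: (kernel_formE (@Vspace_joint _ _ _ _ _ _ _ _ A') (Vspace_fin A')).
apply/eqP; rewrite eq_le; apply/andP; split.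
  apply: ge_ereal_sup => _ [A' [_ A'le] <-].
  rewrite (risk_series _ hphi); apply: lee_nneseries => [k _ _|k _].
    by rewrite lee_fin dotL2_ge0.
  rewrite lee_fin (env_score_decomp SadjP) (mixed_formE SadjP) lerD2r.
  exact: A'le.
apply: lime_le; first by apply: is_cvg_nneseries => k _ _; exact: mixed0.
apply: nearW => N; apply/lee_addgt0Pr => e e0.
rewrite big_mkord sumEFin.
pose G k := normL2 (Sadj (h b k)).
pose s k := normL2 (Num.sqrt gamma *: Vscore A (Sadj (h b k))).
(* For A' within delta of sqrt(gamma) A the k-th term drops by at most 2 delta s_k G_k. With delta =
   e / (M + 1) the total loss is at most e, and M + 1 is positive even if M = 0. *)
pose M := \sum_(k < N) 2 * s k * G k.
have M0 : 0 <= M.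
  by apply: sumr_ge0 => k _; rewrite !mulr_ge0 ?normL2_ge0.
have M1 : 0 < M + 1 by rewrite ltr_wpDl.
have [A' A'C A'e] := hC (divr_gt0 e0 M1).
apply: (@le_trans _ _ (risk (env A') b + e%:E)%E); last first.
  by rewrite leeD2r//; apply: ereal_sup_ubound; exists A'.
apply: (@le_trans _ _ ((\sum_(k < N)
    dotL2 (env_score (env A') (h b k)) (env_score (env A') (h b k)))%:E + e%:E)%E); last first.
  rewrite leeD2r// (risk_series _ hphi) -sumEFin.
  rewrite -(big_mkord xpredT (fun k =>
    (dotL2 (env_score (env A') (h b k)) (env_score (env A') (h b k)))%:E)).
  by apply: nneseries_lim_ge => k _ _; rewrite lee_fin dotL2_ge0.
rewrite -EFinD lee_fin -lerBlDr.
apply: (@le_trans _ _ (\sum_(k < N) (mixed_form (h b k) (h b k) -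
    e / (M + 1) * (2 * s k * G k)))).
  rewrite sumrB -mulr_sumr lerB// -/M mulrAC ler_pdivrMr// ler_wpM2l ?(ltW e0)//.
  by rewrite lerDl.
apply: ler_sum => k _.
rewrite (env_score_decomp SadjP) (mixed_formE SadjP) lerBlDr addrAC lerD2r.
rewrite !kernelV.
have := Vscore_diff (Sadj (h b k)) (divr_gt0 e0 M1) A'e.
rewrite -/(s k) -/(G k).
have -> : gamma * dotL2 (Vscore A (Sadj (h b k))) (Vscore A (Sadj (h b k))) = s k ^+ 2.
  by rewrite normL2_sqr dotL2Zl dotL2Zr mulrA -expr2 sqr_sqrtr ?(ltW hgamma).
rewrite -(normL2_sqr (Vscore A' _)).
have s0 : 0 <= s k by exact: normL2_ge0.
have G0 : 0 <= G k by exact: normL2_ge0.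
have d0 : 0 <= e / (M + 1) by rewrite ltW// divr_gt0.
have n0 := normL2_ge0 (Vscore A' (Sadj (h b k))).
move: (s k) (G k) (e / (M + 1)) (normL2 _) s0 G0 d0 n0 => x y z n x0 y0 z0 n0 le1.
(* If z y <= x, both sides of x - z y <= n are nonnegative and can be squared; otherwise x^2 <= x y
   z is already within the allowed loss 2 x y z. *)
have [xz|xz] := leP (z * y) x.
  have : (x - z * y) ^+ 2 <= n ^+ 2.
    rewrite ler_sqr ?nnegrE ?subr_ge0//; lra.
  have := sqr_ge0 (z * y); rewrite sqrrB; lra.
have := sqr_ge0 n; have := mulr_ge0 x0 (mulr_ge0 z0 y0).
have : x ^+ 2 <= x * (z * y) by rewrite expr2 ler_wpM2l// ltW.
lra.
Qed.

(** The terms are dominated by gamma times those of the risk of A plus those of the risk of O.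
    Finiteness is what allows [argminP] to cancel the common terms of two worst risks. *)
Lemma mixed_series_lty b : (\sum_(k <oo) (mixed_form (h b k) (h b k))%:E < +oo)%E.
Proof.
have [Sadj SadjP] := structural_adjoint.
have RA := risk_lty EA hphi b.
have RO := risk_lty EO hphi b.
rewrite (risk_series _ hphi) in RA; rewrite (risk_series _ hphi) in RO.
apply: (@le_lt_trans _ _ (\sum_(k <oo) (gamma%:E *
   (dotL2 (env_score EA (h b k)) (env_score EA (h b k)))%:E +
   (dotL2 (env_score EO (h b k)) (env_score EO (h b k)))%:E))%E).
  apply: lee_nneseries => [k _ _|k _]; first exact: mixed0.
  rewrite -EFinM -EFinD lee_fin !(env_score_decomp SadjP) (mixed_formE SadjP).
  rewrite kernel_form_zero add0r lerD2r mulrDr lerDl.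
  by rewrite mulr_ge0 ?kernel_form_ge0// ltW.
rewrite nneseriesD; last 2 first.
- by move=> k _ _; rewrite -EFinM lee_fin mulr_ge0 ?dotL2_ge0// ltW.
- by move=> k _ _; rewrite lee_fin dotL2_ge0.
rewrite lte_add_pinfty// nneseriesZl//; last first.
  by move=> k _; rewrite lee_fin dotL2_ge0.
rewrite lte_mul_pinfty// ?lee_fin ?(ltW hgamma)//.
Qed.

End worst_risk.

(** * Minimizers and normal equations *)

Section argmin.
Context (R : realType) (d : measure_display) (T : measurableType d).
Variables (mu : {finite_measure set T -> \bar R}) (p : nat).
Local Notation mu2 := (mu \x mu)%E.
Context (dO : measure_display) (Omega : measurableType dO).
Variables (P : probability Omega R).
Variables (D : set (L2 mu p.+1)) (Top S : L2 mu p.+1 -> L2 mu p.+1).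
Hypothesis hS : structural_operator D Top S.
Variable eps : Vspace P mu p.+1.
Hypothesis heps : bochner_expectation P eps 0.
Variable env : forall A : Vspace P mu p.+1, environment S eps A.
Variables (A : Vspace P mu p.+1) (gamma : R).
Hypothesis hgamma : 0 < gamma.
Local Notation EA := (env A).
Local Notation EO := (env (Vspace_zero P mu p.+1)).
Local Notation mixed := (mixed_form env A gamma).

(** The Riesz representative of v -> B(h, (0, v)) for B = [mixed_form]. Thus K is [mixed_cov] after
    [liftX], and M_k is its value at (phi_k, 0). *)
Definition mixed_cov (h : L2 mu p.+1) : L2 mu p :=
  gamma *: env_cov EA h + (1 - gamma) *: env_cov EO h.

Lemma dot_mixed_cov h v : dotL2 (mixed_cov h) v = mixed h (liftX v).
Proof. by rewrite dotL2Dl !dotL2Zl !dot_env_cov. Qed.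

Lemma calKP (f h : L2 mu p) :
  calK gamma EA EO f h <-> eqL2 h (mixed_cov (liftX f)).
Proof.
by split=> fh j; have := fh j; have := ae_env_kernel EA f j;
  have := ae_env_kernel EO f j;
  apply: filterS3 => t -> -> ->; rewrite L2D !L2Z.
Qed.

Lemma residualE (phi : nat -> L2 mu 1) (b : L2 mu2 p) k : residual phi b k = liftY p (phi k) - liftX (padj b (phi k)).
Proof. by []. Qed.

Opaque mixed_form mixed_cov residual.

Lemma mixed_cov_sym f g :
  dotL2 (mixed_cov (liftX f)) g = dotL2 f (mixed_cov (liftX g)).
Proof. by rewrite dot_mixed_cov (dotL2C f) dot_mixed_cov mixed_formC. Qed.

Lemma mixed_cov_degenerate h f : eqL2 (mixed_cov (liftX f)) 0 ->
  dotL2 (mixed_cov h) f = 0.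
Proof.
move=> f0; rewrite dot_mixed_cov.
apply: (mixed_form_degenerate hS heps hgamma).
by rewrite -dot_mixed_cov (eqL2_dotl _ f0) dotL20l.
Qed.

Lemma calK_injectiveP : calK_injective gamma EA EO <->
  forall f, eqL2 (mixed_cov (liftX f)) 0 -> eqL2 f 0.
Proof.
have lin f g v : dotL2 (mixed_cov (liftX (f - g))) v =
    dotL2 (mixed_cov (liftX f)) v - dotL2 (mixed_cov (liftX g)) v.
  apply: etrans (mixed_cov_sym _ _) _; apply: etrans (dotL2Bl _ _ _) _.
  by congr (_ - _); apply/esym; exact: mixed_cov_sym.
split=> [inj f f0|inj f g h /calKP fh /calKP gh].
  apply: (inj f 0 0); apply/calKP; first exact: eqL2_sym.
  by apply/eqL2_dotP => v; rewrite mixed_cov_sym !dotL20l.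
suff /inj/eqL2_normP : eqL2 (mixed_cov (liftX (f - g))) 0.
  by rewrite subr0 => ?; exact/eqL2_normP.
apply/eqL2_dotP => v.
by rewrite lin -(eqL2_dotl v fh) -(eqL2_dotl v gh) subrr dotL20l.
Qed.

Variable calA : set (Vspace P mu p.+1).
Hypothesis hC : closureV (shift_set gamma calA A) (fun w => Num.sqrt gamma *: A w).
Variable phi : nat -> L2 mu 1.
Hypothesis hphi : orthonormal_basis setT setT phi.
Local Notation h := (residual phi).
Local Notation sol := (solution phi (fun f => mixed_cov (liftX f))
  (fun k => mixed_cov (liftY p (phi k)))).

Lemma solution_residual b : sol b <-> forall k v, mixed (h b k) (liftX v) = 0.
Proof.
have E k v : mixed (h b k) (liftX v) = dotL2 (mixed_cov (liftY p (phi k))) v -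
    dotL2 (mixed_cov (liftX (padj b (phi k)))) v.
  by rewrite residualE mixed_formBl !dot_mixed_cov.
split=> [sb k v|hb k]; first by rewrite E (eqL2_dotl _ (sb k)) subrr.
apply/eqL2_dotP => v; apply/eqP; rewrite eq_sym -subr_eq0 -E.
by apply/eqP; exact: hb.
Qed.

Lemma eqL2_liftX x x' : eqL2 x x' -> eqL2 (liftX x : L2 mu p.+1) (liftX x').
Proof.
by move=> xx'; apply/eqL2_dotP => u; rewrite !(dotL2C _ u) !dot_liftX
  !(dotL2C (tailL2 u)); exact: eqL2_dotl.
Qed.

(** [padj] sends the kernel phi_k (x) v and phi_j to <phi_k, phi_j> v, so only the direction of
    index k moves, by -t (0, v). *)
Lemma mixed_perturb b t k v j :
  mixed (h (b + t *: tensorL2 (phi k) v) j) (h (b + t *: tensorL2 (phi k) v) j) =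
  mixed (h b j) (h b j) - 2 * (t * (k == j)%:R) * mixed (h b j) (liftX v) +
  (t * (k == j)%:R) ^+ 2 * mixed (liftX v) (liftX v).
Proof.
case: hphi => _ on _ _.
pose s := t * (k == j)%:R.
have E : eqL2 (h (b + t *: tensorL2 (phi k) v) j) (h b j - s *: liftX v).
  have : eqL2 (padj (b + t *: tensorL2 (phi k) v) (phi j)) (padj b (phi j) + s *: v).
    apply/eqL2_dotP => u.
    rewrite (dotL2Dl (padj b (phi j))) (dotL2Zl s) !dot_padj_tensor.
    by rewrite dotL2Dl dotL2Zl dot_tensorL2 on// mulrA.
  move=> /eqL2_liftX; rewrite liftXD liftXZ => E; apply/eqL2_dotP => u.
  by rewrite !residualE !dotL2Bl (eqL2_dotl _ E) dotL2Dl opprD addrA.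
by rewrite (mixed_form_eq2 env A gamma E) mixed_form_subZ.
Qed.

(** Varying a minimizer along phi_k (x) v changes a single term of the series, quadratically in t.
    Conversely, the normal equations remove the linear term in every summand, so no B(h_k, h_k) can
    decrease. *)
Lemma argminP b :
  worst_risk_argmin env (shift_set gamma calA A) b <-> sol b.
Proof.
have aux (x y z t : R) : x <= x - 2 * (- t * 1) * y + (- t * 1) ^+ 2 * z ->
    0 <= z * t ^+ 2 + 2 * y * t by lra.
have m0 b' k : (0 <= (mixed (h b' k) (h b' k))%:E)%E.
  by rewrite lee_fin (mixed_form_ge0 hS heps env A hgamma).
have WE b' := worst_riskE hS heps env hgamma hC hphi b'.
rewrite solution_residual; split=> [ab k v|hb b'].
  apply: (@quad_ge0_eq0 _ (mixed (liftX v) (liftX v))) => t.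
  (* The sign turns the linear term into + 2 y t, as in [quad_ge0_eq0]. *)
  pose b' := b + (- t) *: tensorL2 (phi k) v.
  pose rest (b1 : L2 mu2 p) :=
    (\sum_(0 <= j <oo | xpredT j && (j != k)) (mixed (h b1 j) (h b1 j))%:E)%E.
  have split1 b1 : (\sum_(j <oo) (mixed (h b1 j) (h b1 j))%:E =
      (mixed (h b1 k) (h b1 k))%:E + rest b1)%E.
    by apply: (@nneseriesD1 _ (fun j => (mixed (h b1 j) (h b1 j))%:E) k xpredT).
  have rest0 : (0 <= rest b)%E by apply: nneseries_ge0 => *; exact: m0.
  have restE : rest b' = rest b.
    apply: eq_eseriesr => j /andP[_ jk].
    rewrite /b' mixed_perturb eq_sym (negbTE jk) mulr0 mulr0 mul0r subr0.
    by rewrite expr0n mul0r addr0.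
  clearbody rest.
  have resty : rest b \is a fin_num.
    rewrite (ge0_fin_numE rest0).
    apply: le_lt_trans (mixed_series_lty hS heps env A hgamma hphi b).
    by rewrite split1; exact: leeDr.
  have W1 b1 := etrans (WE b1) (split1 b1).
  have := ab b'; rewrite (W1 b) (W1 b') restE (leeD2rE _ _ resty) lee_fin.
  rewrite (mixed_perturb b (- t) k v k : mixed (h b' k) (h b' k) = _).
  by move: (mixed (h b k) (h b k)) (mixed (h b k) (liftX v)) (mixed (liftX v) (liftX v))
    => x y z; rewrite eqxx; exact: aux.
rewrite (WE b) (WE b'); apply: lee_nneseries => [k _ _|k _]; first exact: m0.
rewrite lee_fin.
pose u := padj b' (phi k) - padj b (phi k).
have -> : h b' k = h b k - 1 *: liftX u.
  by rewrite scale1r /u liftXB !residualE opprB addrA subrK.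
rewrite mixed_form_subZ hb mulr0 subr0 expr1n mul1r lerDl.
exact: (mixed_form_ge0 hS heps env A hgamma).
Qed.

End argmin.

(* hC is needed besides hA: for calA = {(1 + 1/n) sqrt(gamma) A : n >= 1} and
   A <> 0, hA holds while the shift set is empty, and then every b is a
   minimizer. It holds for instance when calA contains sqrt(gamma) A. *)
Theorem theorem4p1 (R : realType) (T1 T2 : R) (hT12 : T1 < T2)
  (p : nat) (hp : (1 <= p)%N)
  (d : measure_display) (Omega : measurableType d) (P : probability Omega R)
  (D : set (L2 (leb T1 T2) p.+1))
  (Top S : L2 (leb T1 T2) p.+1 -> L2 (leb T1 T2) p.+1)
  (hS : structural_operator D Top S)
  (eps : Vspace P (leb T1 T2) p.+1) (heps : bochner_expectation P eps 0)
  (env : forall A : Vspace P (leb T1 T2) p.+1, environment S eps A)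
  (A : Vspace P (leb T1 T2) p.+1) (gamma : R) (hgamma : 0 < gamma)
  (calA : set (Vspace P (leb T1 T2) p.+1))
  (hA : closureV calA (fun w => Num.sqrt gamma *: A w))
  (hC : closureV (shift_set gamma calA A) (fun w => Num.sqrt gamma *: A w))
  (EA := env A) (EO := env (Vspace_zero P (leb T1 T2) p.+1))
  (Jpsi Jeta : set nat) (psi eta : nat -> L2 (leb T1 T2) p)
  (phi : nat -> L2 (leb T1 T2) 1)
  (hpsi_eigen : forall l, Jpsi l -> exists2 lambda : R, lambda != 0 &
     calK gamma EA EO (psi l) (lambda *: psi l))
  (hpsi : orthonormal_basis (orthoL2 (kerK gamma EA EO)) Jpsi psi)
  (heta : orthonormal_basis (kerK gamma EA EO) Jeta eta)
  (hphi : orthonormal_basis setT setT phi)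
  (argmin := worst_risk_argmin env (shift_set gamma calA A))
  (c := coef gamma EA EO phi psi) :
  [/\ (exists b0, argmin = [set b | eqL2 b b0]) <->
        summable2 c Jpsi /\ calK_injective gamma EA EO,
      summable2 c Jpsi -> calK_injective gamma EA EO ->
        exists2 b0, tensor_series c phi Jpsi psi b0 &
          argmin = [set b | eqL2 b b0] &
      summable2 c Jpsi -> ~ calK_injective gamma EA EO ->
        exists2 b0, tensor_series c phi Jpsi psi b0 &
          argmin = [set b | exists2 w, tensor_span phi Jeta eta w &
                            eqL2 b (b0 + w)]].
Proof.
pose mu : {finite_measure set (measurableTypeR R) -> \bar R} := leb T1 T2.
pose K (f : L2 mu p) : L2 mu p := mixed_cov env A gamma (liftX f).
pose M (k : nat) : L2 mu p := mixed_cov env A gamma (liftY p (phi k)).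
have Ksym f g : dotL2 (K f) g = dotL2 f (K g) by exact: mixed_cov_sym.
have KM k f : eqL2 (K f) 0 -> dotL2 (M k) f = 0.
  exact: (mixed_cov_degenerate hS heps hgamma).
have kerE : kerK gamma EA EO = [set f : L2 mu p | eqL2 (K f) 0].
  apply/seteqP; split => f.
    by move=> /calKP; exact: eqL2_sym.
  by move=> kf; apply/calKP; exact: eqL2_sym.
have cE : c = (fun k l => dotL2 (M k) (psi l) / dotL2 (K (psi l)) (psi l)).
  apply/funext => k; apply/funext => l.
  rewrite /M /K (dot_mixed_cov env A gamma (liftY p (phi k)))
    (dot_mixed_cov env A gamma (liftX (psi l))).
  by rewrite /c /coef !cross_momentE !square_momentE.
have eig l : Jpsi l ->
    exists2 lambda : R, lambda != 0 & eqL2 (lambda *: psi l) (K (psi l)).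
  by move=> /hpsi_eigen[lambda l0 /calKP el]; exists lambda.
rewrite kerE in hpsi heta.
have argE b : argmin b <-> solution phi K M b.
  exact: (argminP hS heps env hgamma hC hphi).
have injE := calK_injectiveP env A gamma.
have diff b0 b := @solution_diff R _ _ mu p phi K M Ksym b0 b.
(* If Ker K is null, every coefficient function of b - b0 is null, hence so is b - b0 by
   [padj_eq0]. *)
have uniq b0 : solution phi K M b0 -> calK_injective gamma EA EO ->
    argmin = [set b | eqL2 b b0].
  move=> sb0 /injE inj; apply/seteqP; split => b.
    move=> /argE /(diff b0 b sb0) kb.
    apply/eqL2_normP; rewrite -[X in normL2 X]subr0; apply/eqL2_normP.
    by apply: (padj_eq0 hphi) => k; exact: inj (kb k).
  move=> bb0; apply/argE/(diff b0 b sb0) => k.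
  apply/(kerP Ksym) => v; rewrite dot_padj_tensor dotL2Bl.
  by rewrite (eqL2_dotl _ bb0) subrr.
have sol_summable b : solution phi K M b -> summable2 c Jpsi.
  move=> sb; rewrite cE.
  exact: (solution_summable hphi Ksym eig hpsi sb).
have ex_sol : summable2 c Jpsi ->
    exists2 b, tensor_series c phi Jpsi psi b & solution phi K M b.
  rewrite cE => sc.
  exact: (summable_solution hphi Ksym KM eig hpsi heta sc).
split.
- split=> [[b0 argb0]|[/ex_sol[b0 _ sb0] inj]]; last by exists b0; exact: uniq.
  have sb0 : solution phi K M b0.
    by apply/argE; rewrite argb0; exact: eqL2_refl.
  split; first exact: sol_summable sb0.
  apply/injE => f kf.
  (* A kernel vector f yields another minimizer b0 + phi_0 (x) f; uniqueness forces |phi_0 (x) f| =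
     |f| to be 0. *)
  have : argmin (b0 + tensorL2 (phi 0%N) f).
    apply/argE/(diff b0 _ sb0) => k; apply/(kerP Ksym) => v.
    rewrite addrAC subrr add0r dot_padj_tensor dot_tensorL2.
    by rewrite ((kerP Ksym f).1 kf) mulr0.
  rewrite argb0 => /eqL2_normP; rewrite addrAC subrr add0r normL2_tensor.
  case: (hphi) => _ on _ _.
  have -> : normL2 (phi 0%N) = 1 by rewrite /normL2 on// sqrtr1.
  by rewrite mul1r => f0; apply/eqL2_normP; rewrite subr0.
- move=> /ex_sol[b0 tb0 sb0] inj; exists b0 => //; exact: uniq.
move=> /ex_sol[b0 tb0 sb0] _; exists b0 => //.
(* By [solution_diff] the minimizers are b0 plus kernels whose coefficient functions lie in Ker K,
   and these kernels are the elements of [tensor_span]. *)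
apply/seteqP; split => b.
  move=> /argE /(diff b0 b sb0) kb; exists (b - b0).
    exact: (ker_tensor_span hphi heta kb).
  by rewrite addrC subrK; exact: eqL2_refl.
move=> [w wspan bw]; apply/argE/(diff b0 b sb0) => k.
apply/(kerP Ksym) => v; rewrite dot_padj_tensor dotL2Bl (eqL2_dotl _ bw).
rewrite dotL2Dl addrAC subrr add0r -dot_padj_tensor.
by apply: (kerP Ksym _).1; exact: (tensor_span_ker Ksym heta k wspan).
Qed.
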